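(* Let $W(s)=\frac{(s^2-1)^2}{4}$, let $I\subset\mathbb{R}$ be an open bounded interval, and let $0<k<\min\{k_1,\frac12\}$. Let $(u_\varepsilon)\subset W^{2,2}(I)$ be a sequence (indexed by $\varepsilon\to0^+$) such that, for every $\varepsilon$, $u_\varepsilon'=0$ at least in one point of $I$, and satisfying $\liminf_{\varepsilon\to0}F^k_\varepsilon(u_\varepsilon)<+\infty$. Then there exist a subsequence (not relabeled) and a function $u\in BV(I;\{\pm1\})$ such that $u_\varepsilon\to u$ in $L^1(I)$.
   Context: For $u\in W^{2,2}(I)$ and $\varepsilon,k>0$, $$F^k_\varepsilon(u)=\int_I\Big(\frac{W(u)}{\varepsilon}-k\,\varepsilon\,(u')^2+\varepsilon^3(u'')^2\Big)dx .$$ The constant $k_1$ is $$k_1:=\inf_{L>0}\ \inf\Big\{R_{-L}^L(u)\colon u\in W^{2,2}(-L,L),\ u'(\pm L)=0,\ u'\neq0\Big\},$$ where $u'\ne0$ means that $u'$ is not identically zero and, for $a<b$ and $u\in W^{2,2}(a,b)$, $$R_a^b(u):=\frac{\int_a^b(W(u)+(u'')^2)\,dx}{\int_a^b(u')^2\,dx}\ \text{ if } \int_a^b(u')^2\,dx>0,\qquad R_a^b(u):=+\infty\ \text{ otherwise.}$$ Functions in $W^{2,2}$ of an interval are identified with their $C^1$ representatives (up to the closed interval). $BV(I;\{\pm1\})$ is the set of functions of bounded variation on $I$ with values in $\{-1,1\}$ almost everywhere. *)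

(* Defs.v *)
From HB Require Import structures.
From mathcomp Require Import all_boot all_order all_algebra.
From mathcomp Require Import all_classical all_reals all_analysis.

Set Implicit Arguments.
Unset Strict Implicit.
Unset Printing Implicit Defensive.

Import Order.TTheory GRing.Theory Num.Theory.
Import numFieldNormedType.Exports.

Local Open Scope classical_set_scope.
Local Open Scope ring_scope.

(* All function spaces on the open interval ]a, b[ are spaces of functions    *)
(* R -> R whose values outside `[a, b] are irrelevant.                        *)

Definition C1c {R : realType} (a b : R) : set (R -> R) :=
  [set phi : R -> R |
    [/\ forall x : R, derivable phi x 1, continuous (derive1 phi),
        compact (closure [set x | phi x != 0])
      & closure [set x | phi x != 0] `<=` `]a, b[ ] ].

Definition square_integrable {R : realType} (a b : R) (f : R -> R) : Prop :=
  measurable_fun `]a, b[ f /\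
  lebesgue_measure.-integrable `]a, b[ (fun x => (f x ^+ 2)%:E).

(* v is a weak (distributional) derivative of u on ]a, b[; as is usual in one *)
(* dimension, one integrates against C^1_c test functions.                    *)
Definition weak_derivative {R : realType} (a b : R) (u v : R -> R) : Prop :=
  forall phi : R -> R, C1c a b phi ->
    \int[lebesgue_measure]_(x in `]a, b[) (u x * derive1 phi x)
    = - \int[lebesgue_measure]_(x in `]a, b[) (v x * phi x).

(* u \in C^1(`[a, b]) with derivative v: v is the classical derivative of u   *)
(* in the interior, and its values at a and b are the continuous extensions.  *)
Definition C1_closed {R : realType} (a b : R) (u v : R -> R) : Prop :=
  [/\ {within `[a, b], continuous u}, {within `[a, b], continuous v}
    & forall x, x \in `]a, b[ -> is_derive x 1 u (v x)].

(* W^{2,2}(]a, b[): the C^1 representative u, its derivative u' on `[a, b],   *)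
(* and a function u'' representing the weak second derivative, which is       *)
(* determined by u up to a Lebesgue-null set.                                 *)
Record W22 {R : realType} (a b : R) := MkW22 {
  W22_fun :> R -> R ;
  W22_d1 : R -> R ;
  W22_d2 : R -> R ;
  W22_L2_fun : square_integrable a b W22_fun ;
  W22_L2_d1 : square_integrable a b W22_d1 ;
  W22_L2_d2 : square_integrable a b W22_d2 ;
  W22_weak_d1 : weak_derivative a b W22_fun W22_d1 ;
  W22_weak_d2 : weak_derivative a b W22_d1 W22_d2 ;
  W22_C1 : C1_closed a b W22_fun W22_d1 }.

Definition double_well {R : realType} (s : R) : R := (s ^+ 2 - 1) ^+ 2 / 4.

Definition energy {R : realType} (a b k eps : R) (u : W22 a b) : R :=
  \int[lebesgue_measure]_(x in `]a, b[)
    (double_well (u x) / eps - k * eps * W22_d1 u x ^+ 2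
     + eps ^+ 3 * W22_d2 u x ^+ 2).

Definition quotient_R {R : realType} (a b : R) (u : W22 a b) : \bar R :=
  let num := \int[lebesgue_measure]_(x in `]a, b[)
    (double_well (u x) + W22_d2 u x ^+ 2) in
  let den := \int[lebesgue_measure]_(x in `]a, b[) (W22_d1 u x ^+ 2) in
  if 0 < den then (num / den)%:E else +oo%E.

Definition k1_const {R : realType} : \bar R :=
  ereal_inf [set ereal_inf [set quotient_R u | u in
      [set u : W22 (- L) L | [/\ W22_d1 u (- L) = 0, W22_d1 u L = 0
                               & exists2 x, x \in `[- L, L] & W22_d1 u x != 0]]]
    | L in [set L : R | 0 < L]].

(* Total variation of the distributional derivative of u on ]a, b[. It only   *)
(* depends on the a.e.-class of u, unlike the pointwise total_variation.      *)
Definition distributional_variation {R : realType} (a b : R) (u : R -> R) :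
    \bar R :=
  ereal_sup [set (\int[lebesgue_measure]_(x in `]a, b[) (u x * derive1 phi x))%:E
    | phi in [set phi : R -> R | C1c a b phi /\ forall x, `|phi x| <= 1]].

Definition BV {R : realType} (a b : R) (u : R -> R) : Prop :=
  lebesgue_measure.-integrable `]a, b[ (fun x => (u x)%:E) /\
  (distributional_variation a b u < +oo)%E.

Definition BV_pm1 {R : realType} (a b : R) (u : R -> R) : Prop :=
  BV a b u /\
  {ae lebesgue_measure, forall x, x \in `]a, b[ -> u x = -1 \/ u x = 1}.

(* Main.v *)
Require Import Defs.
From HB Require Import structures.
From mathcomp Require Import all_boot all_order all_algebra.
From mathcomp Require Import all_classical all_reals all_analysis.
From mathcomp Require Import measurable_realfun ring lra.

(** Why sequences of bounded energy are compact.

    The energy F = int (W(u) / eps - k eps (u')^2 + eps^3 (u'')^2) is not bounded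
    below term by term, so the first task is to absorb its negative part.  For
    k < k' <= k_1 there is a constant C, depending neither on eps nor on u, with

      k' eps int (u')^2 <= int (W(u) / eps + eps^3 (u'')^2) + C

    for every u whose derivative vanishes somewhere ([interpolation_bound]).  Let
    x1 and x2 be the first and the last zero of u'.  Between them, the blow-up
    t |-> u(c + eps t) has vanishing derivative at both ends of its interval, so
    it competes in the definition of k_1 and the inequality holds with C = 0
    ([neumann_piece]).  On the two remaining intervals u is monotone, and for
    monotone functions with one critical point the inequality holds after blow-up
    with any constant K in place of k', at the price of a constant depending on K
    only ([monotone_bound]).  This rests on the identity

      int G'(u) (u')^2 = [G(u) u'] - int G(u) u''

    for a function G that vanishes at the wells, is dominated by a small multiple
    of the square root of W, and has G' = 1 up to an integrable function of u: the
    defect 1 - G' costs a multiple of sup |u'| only, since u is monotone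
    ([monotone_inner_bound]).  The boundary terms, over which no condition gives
    control, are handled by starting the integration at well chosen points of two
    windows of fixed length at the ends, and by interpolating on these windows
    ([window_trace], [window_interpolation]).  An interval too short to contain the
    windows is harmless: u' vanishes at a point of it, so u'' controls u'.

    Bounded energy therefore bounds int (W(u) / eps + eps (u')^2), and the argument
    of Modica and Mortola applies to z = (3 u - u^3) / 2: the variation of z is
    bounded, z^2 - 1 = W(u) (u^2 - 4) and u - z = u (u^2 - 1) / 2 tend to 0.  The
    compactness of functions of bounded variation in L^1 is proved along an
    ultrafilter ([bv_ultra_limit]), which gives pointwise limits at once; the limit
    of z is the required function, and a subsequence is extracted at the very end.

    The second derivative enters through the weak formulation only.  Testing with
    explicit C^1 cut-offs turns it into the fundamental theorem of calculus for u'
    ([weak_derivative_FTC]), and, after multiplication of the test function by G(u),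
    into the integration by parts above ([W22_by_parts]). *)

Import Order.TTheory GRing.Theory Num.Theory.
Import numFieldNormedType.Exports.
Local Open Scope classical_set_scope.
Local Open Scope ring_scope.
Set Implicit Arguments.
Unset Strict Implicit.
Unset Printing Implicit Defensive.

Notation Ioo_int x y f := (\int[lebesgue_measure]_(t in `]x, y[) f t).
Notation Ioo_integrable x y f := (lebesgue_measure.-integrable `]x, y[ (EFin \o f)).

(** * Integrals over open intervals *)

Section Kit.
Context {R : realType}.
Implicit Types (a b x y c : R) (f g : R -> R).
Notation mu := (@lebesgue_measure R).

Lemma Ioo_integrableS a b x y f : a <= x -> y <= b -> Ioo_integrable a b f ->
  Ioo_integrable x y f.
Proof.
move=> ax yb; apply: integrableS => //.
by apply: subset_itv; rewrite bnd_simp.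
Qed.

Lemma cc_integrable_continuous a b f : {within `[a, b], continuous f} ->
  mu.-integrable `[a, b] (EFin \o f).
Proof. by move=> cf; apply: continuous_compact_integrable => //; exact: segment_compact. Qed.

Lemma Ioo_integrable_continuous a b f : {within `[a, b], continuous f} -> Ioo_integrable a b f.
Proof.
move=> /cc_integrable_continuous; apply: integrableS => //; exact: subset_itv_oo_cc.
Qed.

Lemma Ioo_integrable_measurable a b f : Ioo_integrable a b f -> measurable_fun `]a, b[ f.
Proof. by case/integrableP => /measurable_EFinP. Qed.

Lemma Ioo_integrable_dominated a b f g : measurable_fun `]a, b[ f -> Ioo_integrable a b g ->
  (forall t, t \in `]a, b[ -> `|f t| <= g t) -> Ioo_integrable a b f.
Proof.
move=> mf ig fg; apply: le_integrable ig => //; first by apply/measurable_EFinP.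
by move=> t tab; rewrite /= lee_fin (le_trans (fg _ tab))// ler_norm.
Qed.

Lemma Ioo_integrable_cst a b c : Ioo_integrable a b (fun=> c).
Proof. by apply: Ioo_integrable_continuous => x; exact: cvg_cst. Qed.

Lemma Ioo_integrableD a b f g : Ioo_integrable a b f -> Ioo_integrable a b g ->
  Ioo_integrable a b (fun t => f t + g t).
Proof. by move=> h1 h2; have := integrableD _ h1 h2; exact. Qed.

Lemma Ioo_integrableB a b f g : Ioo_integrable a b f -> Ioo_integrable a b g ->
  Ioo_integrable a b (fun t => f t - g t).
Proof. by move=> h1 h2; have := integrableB _ h1 h2; exact. Qed.

Lemma Ioo_integrableZ a b f c : Ioo_integrable a b f -> Ioo_integrable a b (fun t => c * f t).
Proof. by move=> h; have := integrableZl _ c h; exact. Qed.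

Lemma Ioo_integrable_norm a b f : Ioo_integrable a b f -> Ioo_integrable a b (fun t => `|f t|).
Proof. by move=> h; have := integrable_norm h. Qed.

Lemma Ioo_intD a b f g : Ioo_integrable a b f -> Ioo_integrable a b g ->
  Ioo_int a b (fun t => f t + g t) = Ioo_int a b f + Ioo_int a b g.
Proof. by move=> *; rewrite RintegralD. Qed.

Lemma Ioo_intB a b f g : Ioo_integrable a b f -> Ioo_integrable a b g ->
  Ioo_int a b (fun t => f t - g t) = Ioo_int a b f - Ioo_int a b g.
Proof. by move=> *; rewrite RintegralB. Qed.

Lemma Ioo_intZ a b f c : Ioo_integrable a b f ->
  Ioo_int a b (fun t => c * f t) = c * Ioo_int a b f.
Proof. by move=> *; rewrite RintegralZl. Qed.

Lemma Ioo_int_cst a b c : a <= b -> Ioo_int a b (fun=> c) = c * (b - a).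
Proof.
rewrite Rintegral_cst//= lebesgue_measure_itv/= lte_fin.
rewrite le_eqVlt => /predU1P[->|->]; by rewrite /= ?ltxx ?subrr.
Qed.

Lemma Ioo_int_empty a b f : b <= a -> Ioo_int a b f = 0.
Proof. by move=> ba; rewrite set_itv_ge ?Rintegral_set0// bnd_simp -leNgt. Qed.

Lemma Ioo_int_ge0 a b f : (forall t, t \in `]a, b[ -> 0 <= f t) -> 0 <= Ioo_int a b f.
Proof. by move=> h; apply: Rintegral_ge0 => t; apply: h. Qed.

Lemma Ioo_int_le a b f g : Ioo_integrable a b f -> Ioo_integrable a b g ->
  (forall t, t \in `]a, b[ -> f t <= g t) -> Ioo_int a b f <= Ioo_int a b g.
Proof. by move=> *; apply: le_Rintegral. Qed.

Lemma Ioo_int_norm a b f : Ioo_integrable a b f ->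
  `|Ioo_int a b f| <= Ioo_int a b (fun t => `|f t|).
Proof. by move=> *; apply: le_normr_Rintegral. Qed.

Lemma eq_Ioo_int a b f g : (forall t, t \in `]a, b[ -> f t = g t) ->
  Ioo_int a b f = Ioo_int a b g.
Proof. by move=> h; apply: eq_Rintegral => t; rewrite inE/= => /h. Qed.

Lemma Ioo_int_split a x b f : a <= x -> x <= b -> Ioo_integrable a b f ->
  Ioo_int a b f = Ioo_int a x f + Ioo_int x b f.
Proof.
move=> ax xb h; have [<-|xb'] := eqVneq x b; first by rewrite (Ioo_int_empty f (lexx x)) addr0.
have xltb : x < b by rewrite lt_neqAle xb' xb.
have := @Rintegral_itvB R f (BRight a) (BLeft b) x h.
rewrite !bnd_simp => /(_ ax xltb) <-.
rewrite (@Rintegral_itv_bndo_bndc R (BRight a) x); last exact: Ioo_integrableS h.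
lra.
Qed.

Lemma Ioo_int_subitv a b x y f : a <= x -> x <= y -> y <= b -> Ioo_integrable a b f ->
  (forall t, t \in `]a, b[ -> 0 <= f t) -> Ioo_int x y f <= Ioo_int a b f.
Proof.
move=> ax xy yb h f0.
rewrite (@Ioo_int_split a x b)// ?(le_trans xy)//.
rewrite (@Ioo_int_split x y b)//; last exact: Ioo_integrableS h.
have h1 : 0 <= Ioo_int a x f.
  apply: Ioo_int_ge0 => t; rewrite in_itv/= => /andP[h1 h2]; apply: f0.
  by rewrite in_itv/= h1 (lt_le_trans h2)// (le_trans xy).
have h2 : 0 <= Ioo_int y b f.
  apply: Ioo_int_ge0 => t; rewrite in_itv/= => /andP[h2 h3]; apply: f0.
  by rewrite in_itv/= h3 andbT (le_lt_trans _ h2)// (le_trans ax).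
lra.
Qed.

(** The slack e spares a discussion of strict positivity of integrals; it is
    absorbed by the additive constants of the estimates that use this lemma. *)
Lemma exists_le_average x y f e : x < y -> 0 < e -> Ioo_integrable x y f ->
  exists2 t, t \in `]x, y[ & f t * (y - x) <= Ioo_int x y f + e.
Proof.
move=> xy e0 h; apply: contrapT => /forall2NP H.
have yx : 0 < y - x by rewrite subr_gt0.
have : Ioo_int x y f + e <= Ioo_int x y f; last by lra.
have -> : Ioo_int x y f + e = Ioo_int x y (fun=> (Ioo_int x y f + e) / (y - x)).
  by rewrite Ioo_int_cst ?ltW// divfK// gt_eqF.
apply: Ioo_int_le; [exact: Ioo_integrable_cst|by []|] => t txy.
have [//|/negP] := H t.
by rewrite -ltNge => /ltW; rewrite ler_pdivrMr.
Qed.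

Lemma Ioo_int_FTC2 p q f F : p <= q -> {within `[p, q], continuous f} ->
  {within `[p, q], continuous F} ->
  (forall x, x \in `]p, q[ -> is_derive x 1 F (f x)) ->
  Ioo_int p q f = F q - F p.
Proof.
rewrite le_eqVlt => /predU1P[<- _ _ _|pq cf cF dF].
  by rewrite Ioo_int_empty// subrr.
have h : derivable_oo_LRcontinuous F p q.
  have /continuous_within_itvP := cF => /(_ pq) [c1 c2 c3]; split => //.
  by move=> x /dF [].
have := continuous_FTC2 pq cf h.
rewrite -EFinB => H.
rewrite Rintegral_itv_bndo_bndc; last first.
  have /integrableS := cc_integrable_continuous cf; apply => //.
  by apply: subset_itv; rewrite bnd_simp.
rewrite Rintegral_itv_obnd_cbnd; last first.
  have /integrableS := cc_integrable_continuous cf; apply => //.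
  by apply: subset_itv; rewrite bnd_simp.
rewrite /Rintegral H// => x /dF [_ <-].
by rewrite derive1E.
Qed.

Lemma affine_measurable c s : measurable_fun setT (fun t : measurableTypeR R => c +
  s * t : measurableTypeR R).
Proof.
apply: measurable_funD => //; exact: measurable_funM.
Qed.

Section affine.
Variables (c s : R).
Hypothesis s0 : 0 < s.
Let phi (t : measurableTypeR R) : measurableTypeR R := c + s * t.
Let pm : {measure set (measurableTypeR R) -> \bar R} :=
  measure_function_pushforward__canonical__measure_function_Measure mu (affine_measurable c s).
Let nu := mscale (NngNum (ltW s0)) pm.

Lemma affine_preim (b0 b1 : bool) x y : phi @^-1` [set` Interval (BSide b0 x) (BSide b1 y)] =
  [set` Interval (BSide b0 ((x - c) / s)) (BSide b1 ((y - c) / s))].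
Proof.
apply/seteqP; split => t /=; rewrite /phi !itv_boundlr /=;
 case: b0; case: b1; rewrite !bnd_simp/= ?ler_pdivrMr ?ltr_pdivrMr ?ler_pdivlMr ?ltr_pdivlMr//
  [t * s]mulrC => /andP[h1 h2]; apply/andP; split; lra.
Qed.

(** The image of Lebesgue measure under the affine map, scaled by s, agrees with
    Lebesgue measure on half-open intervals, and these determine it. *)
Lemma affine_measure A : measurable A -> mu A = nu A.
Proof.
apply: lebesgue_measure_unique => X [[x y] _ <-]/=.
rewrite /nu /mscale/= /pushforward affine_preim !lebesgue_measure_itv/= !lte_fin.
rewrite ltr_pM2r ?invr_gt0// ltrD2r; case: ltP => xy; last by rewrite mule0.
by rewrite -!EFinB -EFinM; congr (_%:E); field; rewrite gt_eqF.
Qed.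

Lemma ge0_affine_integral D (f : measurableTypeR R -> \bar R) : measurable D ->
  measurable_fun D f -> (forall t, D t -> 0 <= f t)%E ->
  (\int[mu]_(t in D) f t = s%:E * \int[mu]_(t in phi @^-1` D) f (phi t))%E.
Proof.
move=> mD mf f0.
rewrite (@eq_measure_integral _ _ _ _ nu)//; last first.
  by move=> A mA _; apply: affine_measure.
rewrite ge0_integral_mscale//.
congr (_ * _)%E.
rewrite (@ge0_integral_pushforward _ _ _ _ R phi (affine_measurable c s))//.
by move=> t /[!inE] /f0.
Qed.

Lemma affine_preim_oo x y : phi @^-1` `]c + s * x, c + s * y[ = `]x, y[%classic.
Proof.
have e z : (c + s * z - c) / s = z by rewrite (addrC c) addrK mulrC mulKf ?gt_eqF.
by rewrite affine_preim !e.
Qed.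

Lemma affine_measurable_comp x y (f : R -> R) : measurable_fun `]c + s * x, c + s * y[ f ->
  measurable_fun `]x, y[ (fun t => f (c + s * t)).
Proof.
move=> mf; apply: (@measurable_comp _ _ _ _ _ _ `]c + s * x, c + s * y[ f) => //.
  move=> _ [t + <-]; rewrite /= !in_itv/= => /andP[xt ty].
  by rewrite !ltrD2l !ltr_pM2l// xt.
exact: measurable_funTS (affine_measurable c s).
Qed.

Lemma affine_Ioo_integrable x y (f : R -> R) : Ioo_integrable (c + s * x) (c + s * y) f ->
  Ioo_integrable x y (fun t => f (c + s * t)).
Proof.
move=> /integrableP [/measurable_EFinP mf foo]; apply/integrableP; split.
  by apply/measurable_EFinP; exact: affine_measurable_comp.
move: foo; rewrite ge0_affine_integral//; last first.
  by do 2 apply: measurableT_comp => //.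
rewrite affine_preim_oo => H; rewrite ltey; apply/negP => /eqP E.
by move: H; rewrite /phi/= E gt0_muley ?lte_fin// ltxx.
Qed.

Lemma affine_Ioo_int x y (f : R -> R) : Ioo_integrable (c + s * x) (c + s * y) f ->
  Ioo_int (c + s * x) (c + s * y) f = s * Ioo_int x y (fun t => f (c + s * t)).
Proof.
move=> h; have h' := affine_Ioo_integrable h; rewrite /Rintegral.
have fin : (\int[mu]_(t in `]x, y[) (f (c + s * t))%:E)%E \is a fin_num.
  by apply: integrable_fin_num.
rewrite [RHS](_ : _ = fine (s%:E * \int[mu]_(t in `]x, y[) (f (c + s * t))%:E)%E); last first.
  by rewrite fineM.
congr fine.
case/integrableP : h => mf _.
rewrite integralE [in RHS]integralE.
rewrite [X in (X - _)%E = _]ge0_affine_integral//; last exact: measurable_funepos.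
rewrite [X in (_ - X)%E = _]ge0_affine_integral//; last exact: measurable_funeneg.
rewrite !affine_preim_oo /phi [RHS]muleBr//.
  by congr (_ * _ - _ * _)%E; apply: eq_integral => t _; rewrite ?funeposE ?funenegE.
apply: fin_num_adde_defr.
apply: integrable_fin_num => //.
exact: (integrable_funepos _ h').
Qed.

End affine.
End Kit.

(** * Explicit cut-off functions *)

Section Step.
Context {R : realType}.
Implicit Types (a b x y c t s : R) (f g : R -> R).

(** Formulas with absolute values have no rule of differentiation at the kinks;
    a quadratic remainder can be checked by cases. *)
Lemma is_derive_quadratic f x d C :
  (forall h, `|f (x + h) - f x - d * h| <= C * h ^+ 2) -> is_derive x 1 f d.
Proof.
move=> H.
have Cp : 0 < C + 1.
  by apply: ltr_wpDl => //; have := H 1; rewrite expr1n !mulr1; apply: le_trans.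
have {}H h : `|f (x + h) - f x - d * h| <= (C + 1) * h ^+ 2.
  by rewrite (le_trans (H h))// ler_wpM2r ?sqr_ge0// lerDl.
have cv : h^-1 *: (f (h *: 1 + x) - f x) @[h --> 0^'] --> d.
  apply/cvgrPdist_le => e e0; near=> h.
  have h0 : h != 0 by near: h; exact: nbhs_dnbhs_neq.
  have -> : d - h^-1 *: (f (h *: (1 : R) + x) - f x) = - (h^-1 * (f (x + h) - f x - d * h)).
    rewrite /GRing.scale/= mulr1 [h + x]addrC; field.
    by [].
  rewrite normrN normrM normfV.
  have hn : 0 < `|h| by rewrite normr_gt0 h0.
  rewrite ler_pdivrMl// (le_trans (H h))//.
  have -> : h ^+ 2 = `|h| * `|h| by rewrite -expr2 real_normK ?num_real.
  rewrite mulrCA ler_wpM2l//.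
  rewrite mulrC -ler_pdivlMr//.
  near: h; by apply: dnbhs0_le; rewrite divr_gt0.
by apply: DeriveDef; [apply/cvg_ex; exists d|apply/cvg_lim].
Unshelve. all: by end_near. Qed.

(** The function t |t| is C^1 with derivative 2 |t|, which is Lipschitz; hence
    this Taylor estimate across the origin. *)
Lemma mul_norm_expansion (x h : R) :
  `|(x + h) * `|x + h| - x * `|x| - 2 * `|x| * h| <= h ^+ 2.
Proof.
rewrite ler_norml.
have [x0|x0] := leP 0 x; have [xh|xh] := leP 0 (x + h).
all: rewrite ?(ger0_norm x0) ?(ltr0_norm x0) ?(ger0_norm xh) ?(ltr0_norm xh).
all: apply/andP; split; nra.
Qed.

(** A combination of translates of s |s| that is 0 for s <= 0 and 1 for s >= 2.
    Its derivative is the tent function supported in [0, 2]. This gives a C^1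
    transition without gluing of pieces. *)
Definition smoothstep (s : R) : R := 2^-1 + (s * `|s| - 2 * ((s - 1) * `|s - 1|) +
  (s - 2) * `|s - 2|) / 4.
Definition smoothstep' (s : R) : R := (`|s| - 2 * `|s - 1| + `|s - 2|) / 2.

Lemma smoothstep_eq0 s : s <= 0 -> smoothstep s = 0.
Proof. move=> s0; rewrite /smoothstep !ler0_norm; lra. Qed.

Lemma smoothstep_eq1 s : 2 <= s -> smoothstep s = 1.
Proof. move=> s0; rewrite /smoothstep !ger0_norm; lra. Qed.

Lemma smoothstep_itv s : 0 <= smoothstep s <= 1.
Proof.
have [s0|s0] := leP s 0; first by rewrite smoothstep_eq0// lexx ler01.
have [s2|s2] := leP 2 s; first by rewrite smoothstep_eq1// lexx ler01.
rewrite /smoothstep (gtr0_norm s0) (@ltr0_norm _ (s - 2)); last lra.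
have [s1|s1] := leP 0 (s - 1).
  rewrite (ger0_norm s1); apply/andP; split; nra.
rewrite (ltr0_norm s1); apply/andP; split; nra.
Qed.

Lemma smoothstep'_eq0 s : s <= 0 \/ 2 <= s -> smoothstep' s = 0.
Proof.
by move=> [s0|s0]; rewrite /smoothstep'; [rewrite !ler0_norm|rewrite !ger0_norm]; lra.
Qed.

Lemma smoothstep'_ge0 s : 0 <= smoothstep' s.
Proof.
have [s0|s0] := leP s 0; first by rewrite smoothstep'_eq0//; left.
have [s2|s2] := leP 2 s; first by rewrite smoothstep'_eq0//; right.
rewrite /smoothstep' (gtr0_norm s0) (@ltr0_norm _ (s - 2)); last lra.
by have [s1|s1] := leP 0 (s - 1); [rewrite (ger0_norm s1)|rewrite (ltr0_norm s1)]; lra.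
Qed.

Lemma continuous_smoothstep' : continuous smoothstep'.
Proof.
move=> s; apply: cvgM; last exact: cvg_cst.
have cn c : `|t - c| @[t --> s] --> `|s - c|.
  by apply: cvg_norm; apply: cvgB; [exact: cvg_id|exact: cvg_cst].
apply: cvgD; last exact: cn.
apply: cvgB; first exact: cvg_norm.
by apply: cvgM; [exact: cvg_cst|exact: cn].
Qed.

Lemma is_derive_smoothstep (s : R) : is_derive s 1 smoothstep (smoothstep' s).
Proof.
apply: (@is_derive_quadratic _ _ _ 1) => h; rewrite mul1r /smoothstep /smoothstep'.
have e1 : s + h - 1 = (s - 1) + h by ring.
have e2 : s + h - 2 = (s - 2) + h by ring.
rewrite e1 e2 ler_norml.
have := mul_norm_expansion s h; rewrite ler_norml => /andP[? ?].
have := mul_norm_expansion (s - 1) h; rewrite ler_norml => /andP[? ?].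
have := mul_norm_expansion (s - 2) h; rewrite ler_norml => /andP[? ?].
apply/andP; split; lra.
Qed.

(** The transition from 0 to 1 takes place on [x, x + 2 / n], and bump n x is a
    probability density on that interval. *)
Definition ramp (n x t : R) := smoothstep (n * (t - x)).
Definition bump (n x t : R) := n * smoothstep' (n * (t - x)).

Lemma is_derive_ramp n x t : is_derive t 1 (ramp n x) (bump n x t).
Proof.
have d1 : is_derive t 1 (fun t => n * (t - x)) n.
  have -> : (fun t => n * (t - x)) = n *: (id - cst x) by [].
  by apply: is_derive_eq; rewrite subr0 /GRing.scale/= mulr1.
have := @is_derive1_comp R smoothstep (fun t => n * (t - x)) t _ _ (is_derive_smoothstep _) d1.
by move/is_derive_eq; apply; rewrite mulrC.
Qed.

Lemma continuous_bump n x : continuous (bump n x).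
Proof.
move=> t; apply: cvgM; first exact: cvg_cst.
apply: (@continuous_comp _ _ _ (fun t => n * (t - x)) smoothstep');
  last exact: continuous_smoothstep'.
apply: cvgM; first exact: cvg_cst.
by apply: cvgB; [exact: cvg_id|exact: cvg_cst].
Qed.

Lemma continuous_ramp n x : continuous (ramp n x).
Proof.
by move=> t; apply/differentiable_continuous/derivable1_diffP; have [] := is_derive_ramp n x t.
Qed.

Lemma bump_ge0 n x t : 0 <= n -> 0 <= bump n x t.
Proof. by move=> n0; rewrite mulr_ge0// smoothstep'_ge0. Qed.

Lemma Ioo_int_bump a b n x : 0 < n -> a <= x -> x + 2 / n <= b -> Ioo_int a b (bump n x) = 1.
Proof.
move=> n0 ax xb.
have x2 : 0 < 2 / n by rewrite divr_gt0.
have -> : Ioo_int a b (bump n x) = ramp n x b - ramp n x a.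
  apply: Ioo_int_FTC2.
  - by rewrite (le_trans ax)// (le_trans _ xb)// lerDl ltW.
  - by apply: continuous_subspaceT; exact: continuous_bump.
  - by apply: continuous_subspaceT; exact: continuous_ramp.
  - by move=> t _; exact: is_derive_ramp.
rewrite /ramp smoothstep_eq1 ?smoothstep_eq0 ?subr0//.
- by rewrite pmulr_rle0// subr_le0.
- by rewrite mulrC -ler_pdivrMr// lerBrDl.
Qed.

(** Averages against bump n x see only the values on [x, x + 2 / n]. *)
Lemma Ioo_int_bump_near a b n x W e : 0 < n -> a <= x -> x + 2 / n <= b ->
  Ioo_integrable a b (fun t => W t * bump n x t) ->
  (forall t, t \in `]a, b[ -> x <= t <= x + 2 / n -> `|W t - W x| <= e) ->
  `|Ioo_int a b (fun t => W t * bump n x t) - W x| <= e.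
Proof.
move=> n0 ax xb iW H.
have is_ : Ioo_integrable a b (bump n x).
  by apply: Ioo_integrable_continuous; apply: continuous_subspaceT; exact: continuous_bump.
rewrite -[in X in _ - X](mulr1 (W x)) -(Ioo_int_bump n0 ax xb) -Ioo_intZ// -Ioo_intB//;
  last exact: Ioo_integrableZ.
apply: le_trans; first by apply: Ioo_int_norm; apply: Ioo_integrableB => //;
  exact: Ioo_integrableZ.
rewrite -[leRHS]mulr1 -(Ioo_int_bump n0 ax xb) -Ioo_intZ//.
apply: Ioo_int_le; first by apply: Ioo_integrable_norm; apply: Ioo_integrableB => //;
  exact: Ioo_integrableZ.
  exact: Ioo_integrableZ.
move=> t tab; rewrite -mulrBl normrM (ger0_norm (bump_ge0 _ _ (ltW n0))).
have [tx|tx] := leP t x.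
  by rewrite /bump smoothstep'_eq0 ?mulr0//; left; rewrite pmulr_rle0// subr_le0.
have [tx2|tx2] := leP (x + 2 / n) t.
  rewrite /bump smoothstep'_eq0 ?mulr0//; right.
  by rewrite mulrC -ler_pdivrMr// lerBrDl.
apply: ler_wpM2r; first exact/bump_ge0/ltW.
by apply: H => //; rewrite (ltW tx) (ltW tx2).
Qed.

(** The difference of two ramps is a C^1 version of the indicator function of
    the interval between x and y. *)
Lemma C1c_cutoff a b x y n : 0 < n -> a < x -> x < y -> y + 2 / n < b ->
  C1c a b (fun t => ramp n x t - ramp n y t).
Proof.
move=> n0 ax xy yb.
have x2 : 0 < 2 / n by rewrite divr_gt0.
have dp t : is_derive t 1 (fun t => ramp n x t - ramp n y t) (bump n x t - bump n y t).
  by apply: is_deriveB; exact: is_derive_ramp.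
have sK : closure [set t | ramp n x t - ramp n y t != 0] `<=` `[x, y + 2 / n]%classic.
  rewrite [X in _ `<=` X]((closure_id _).1 _); last exact: itv_closed.
  apply: closure_subset => t /= /eqP; rewrite in_itv/=.
  apply: contra_notT; rewrite negb_and -!ltNge /ramp => /orP[tx|ty].
    rewrite !smoothstep_eq0 ?subrr// pmulr_rle0// subr_le0 ltW//.
    by rewrite (lt_trans tx).
  rewrite !smoothstep_eq1 ?subrr// mulrC -ler_pdivrMr// lerBrDl ltW//.
  by rewrite (le_lt_trans _ ty)// lerD2r ltW.
split.
- by move=> t; have [] := dp t.
- have -> : derive1 (fun t => ramp n x t - ramp n y t) = (fun t => bump n x t - bump n y t).
    by apply/funext => t; rewrite derive1E; have [_] := dp t.
  by move=> t; apply: cvgB; exact: continuous_bump.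
- apply: (subclosed_compact _ (@segment_compact R x (y + 2 / n))) => //.
  exact: closed_closure.
- by apply: subset_trans sK _; apply: subset_itv; rewrite bnd_simp.
Qed.

Lemma derive1_cutoff x y n : derive1 (fun t => ramp n x t - ramp n y t) =
  (fun t => bump n x t - bump n y t).
Proof.
apply/funext => t; rewrite derive1E.
by have [_] : is_derive t 1 (fun t => ramp n x t - ramp n y t) (bump n x t - bump n y t)
  by apply: is_deriveB; exact: is_derive_ramp.
Qed.

End Step.

(** * The fundamental theorem of calculus for weak derivatives *)

Section WeakFTC.
Context {R : realType}.
Implicit Types (a b x y c t s : R) (f g W H : R -> R).
Notation mu := (@lebesgue_measure R).

Lemma within_bounded a b f : {within `[a, b], continuous f} ->
  exists M, forall t, t \in `[a, b] -> `|f t| <= M.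
Proof.
move=> cf.
have := @compact_bounded _ R (f @` `[a, b]%classic) (continuous_compact cf
  (@segment_compact R a b)).
move=> [M [_ /(_ (M + 1))]]; rewrite ltrDl ltr01 => /(_ isT) H.
by exists (M + 1) => t tab; apply: H; exists t.
Qed.

Lemma Ioo_integrable_continuousM a b f g : {within `[a, b], continuous f} ->
  Ioo_integrable a b g ->
  Ioo_integrable a b (fun t => f t * g t).
Proof.
move=> cf ig; have [ba|ab] := leP b a.
  apply: (Ioo_integrable_dominated (g := cst 0)) => //.
  - by rewrite set_itv_ge ?bnd_simp -?leNgt//; exact: measurable_fun_set0.
  - by rewrite set_itv_ge ?bnd_simp -?leNgt//; exact: integrable_set0.
  - by move=> t; rewrite in_itv/= => /andP[a1 a2]; have := lt_trans a1 a2; rewrite ltNge ba.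
have [M HM] := within_bounded cf.
apply: (Ioo_integrable_dominated (g := fun t => M * `|g t|)).
- apply: measurable_funM; last exact: Ioo_integrable_measurable.
  by apply: Ioo_integrable_measurable; exact: Ioo_integrable_continuous.
- exact/Ioo_integrableZ/Ioo_integrable_norm.
- move=> t tab; rewrite normrM ler_wpM2r// HM//.
  by move: tab; rewrite !in_itv/= => /andP[/ltW -> /ltW ->].
Qed.

Lemma Ioo_integrableM_continuous a b f g : {within `[a, b], continuous f} ->
  Ioo_integrable a b g ->
  Ioo_integrable a b (fun t => g t * f t).
Proof.
move=> cf ig; have -> : (fun t => g t * f t) = (fun t => f t * g t).
  by apply/funext => t; rewrite mulrC.
exact: Ioo_integrable_continuousM.
Qed.

Lemma cutoff_integrable a b x y n H : Ioo_integrable a b H ->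
  Ioo_integrable a b (fun t => H t * (ramp n x t - ramp n y t)).
Proof.
move=> iH; apply: Ioo_integrableM_continuous iH; apply: continuous_subspaceT => t.
by apply: cvgB; exact: continuous_ramp.
Qed.

Lemma bump_integrable a b x n H : Ioo_integrable a b H ->
  Ioo_integrable a b (fun t => H t * bump n x t).
Proof.
move=> iH; by apply: Ioo_integrableM_continuous iH; apply: continuous_subspaceT;
  exact: continuous_bump.
Qed.

Lemma ramp_cvg x t : (fun k => ramp k.+1%:R x t) @ \oo --> ((x < t)%R%:R : R).
Proof.
apply: cvg_near_cst; have [tx|xt] := leP t x.
  by apply: nearW => k; rewrite /ramp smoothstep_eq0// pmulr_rle0// subr_le0.
near=> k; rewrite /ramp smoothstep_eq1// mulrC -ler_pdivrMl ?subr_gt0//.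
rewrite (@le_trans _ _ k%:R)// ?ler_nat//.
by near: k; exact: nbhs_infty_ger.
Unshelve. all: by end_near. Qed.

Lemma Ioo_int_cutoff_cvg a b x y H : a < x -> x < y -> y < b -> Ioo_integrable a b H ->
  (fun k => Ioo_int a b (fun t => H t * (ramp k.+1%:R x t - ramp k.+1%:R y t))) @ \oo
  --> Ioo_int x y H.
Proof.
move=> ax xy yb iH.
have mH := Ioo_integrable_measurable iH.
pose s t : R := (x < t)%R%:R - (y < t)%R%:R.
have sE t : s t = (t \in `]x, y])%:R.
  rewrite /s in_itv/=; have [xt|xt] := ltP x t; have [ty|ty] := ltP y t => //=.
  - by rewrite subrr.
  - by rewrite subr0.
  - by have := lt_le_trans (lt_trans xy ty) xt; rewrite ltxx.
  - by rewrite subrr.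
have iHs : Ioo_integrable a b (fun t => H t * s t).
  apply: (Ioo_integrable_dominated (g := fun t => `|H t|)); last 1 first.
  - move=> t tab; rewrite normrM sE; case: (t \in _); by rewrite ?normr1 ?mulr1 ?normr0 ?mulr0.
  - apply: measurable_funM => //.
    have -> : s = \1_(`]x, y]%classic : set R).
      by apply/funext => t; rewrite sE indicE mem_setE.
    exact: measurable_indic.
  - exact: Ioo_integrable_norm.
have e : Ioo_int a b (fun t => H t * s t) = Ioo_int x y H.
  rewrite (@Ioo_int_split _ a x b)//; [|exact: ltW|exact/ltW/(lt_trans xy)].
  have iHs' : Ioo_integrable x b (fun t => H t * s t)
    by apply: Ioo_integrableS iHs; [exact: ltW|by []].
  rewrite (@Ioo_int_split _ x y b)//; [|exact: ltW|exact: ltW].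
  rewrite (@eq_Ioo_int _ a x _ (fun=> 0)); last first.
    by move=> t; rewrite in_itv/= => /andP[_ tx]; rewrite sE in_itv/= ltNge (ltW tx) mulr0.
  rewrite (@eq_Ioo_int _ y b _ (fun=> 0)); last first.
    by move=> t; rewrite in_itv/= => /andP[yt _]; rewrite sE in_itv/= leNgt yt andbF mulr0.
  rewrite (@eq_Ioo_int _ x y _ H); last first.
    by move=> t; rewrite in_itv/= => /andP[xt ty]; rewrite sE in_itv/= xt (ltW ty) mulr1.
  by rewrite !Ioo_int_cst ?mul0r ?add0r ?addr0// ltW.
have DC := @dominated_convergence _ _ _ mu `]a, b[%classic (measurable_itv _)
  (fun k t => (H t * (ramp k.+1%:R x t - ramp k.+1%:R y t))%:E)
  (fun t => (H t * s t)%:E)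
  (fun t => `|H t|%:E).
have [] := DC.
- by move=> k; apply/measurable_EFinP; apply: Ioo_integrable_measurable; exact: cutoff_integrable.
- by apply/measurable_EFinP; apply: Ioo_integrable_measurable.
- apply: aeW => t _; apply: cvg_EFin; first by apply: nearW.
  apply: cvgM; first exact: cvg_cst.
  by apply: cvgB; exact: ramp_cvg.
- exact: Ioo_integrable_norm.
- apply: aeW => t k _; rewrite /= lee_fin normrM ler_piMr//.
  have /andP[? ?] := smoothstep_itv (k.+1%:R * (t - x)).
  have /andP[? ?] := smoothstep_itv (k.+1%:R * (t - y)).
  by rewrite /ramp ler_norml; apply/andP; split; lra.
move=> _ _ cv; rewrite -e /Rintegral.
apply: fine_cvg; rewrite fineK//.
exact: integrable_fin_num.
Qed.

(** The derivative of the cut-off is a difference of two bumps, which concentrate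
    at x and y as n grows, whereas the cut-off itself tends to the indicator of
    the interval. Testing the weak derivative with it gives the formula in the
    limit. *)
Lemma weak_derivative_FTC a b x y W H : a < x -> x <= y -> y < b ->
  (forall t, t \in `]a, b[ -> {for t, continuous W}) ->
  Ioo_integrable a b W -> Ioo_integrable a b H -> weak_derivative a b W H ->
  W y - W x = Ioo_int x y H.
Proof.
move=> ax; rewrite le_eqVlt => /predU1P[<- _ _ _ _ _|xy yb cW iW iH wd].
  by rewrite subrr Ioo_int_empty.
apply/eqP; rewrite -subr_eq0 -normr_le0; apply/ler_addgt0Pr => e e0; rewrite add0r.
have e3 : 0 < e / 3 by rewrite divr_gt0.
have xab : x \in `]a, b[ by rewrite in_itv/= ax (lt_trans xy).
have yab : y \in `]a, b[ by rewrite in_itv/= yb (lt_trans ax).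
have /cvgrPdist_le/(_ _ e3) [d1 /= d10 D1] := cW _ xab.
have /cvgrPdist_le/(_ _ e3) [d2 /= d20 D2] := cW _ yab.
have /cvgrPdist_le/(_ _ e3) cv := Ioo_int_cutoff_cvg ax xy yb iH.
near \oo => k.
pose n : R := k.+1%:R.
have n0 : 0 < n by [].
have small d : 0 < d -> 2 / d < k%:R -> 2 / n < d.
  move=> d0 h; rewrite ltr_pdivrMr// mulrC -ltr_pdivrMr//.
  by rewrite (lt_le_trans h)// ler_nat.
have s1 : 2 / n < d1 by apply: small => //; near: k; exact: nbhs_infty_gtr.
have s2 : 2 / n < d2 by apply: small => //; near: k; exact: nbhs_infty_gtr.
have s3 : y + 2 / n < b.
  rewrite -ltrBrDl; apply: small; first by rewrite subr_gt0.
  by near: k; exact: nbhs_infty_gtr.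
have s4 : x + 2 / n <= b by rewrite (le_trans _ (ltW s3))// lerD2r ltW.
have E := wd _ (C1c_cutoff n0 ax xy s3).
rewrite derive1_cutoff in E.
have h1 : `|Ioo_int a b (fun t => W t * bump n x t) - W x| <= e / 3.
  apply: (Ioo_int_bump_near n0 (ltW ax) s4); first exact: bump_integrable.
  move=> t tab /andP[xt tx]; rewrite distrC; apply: D1 => /=.
  by rewrite distrC ger0_norm ?subr_ge0// ltrBlDl (le_lt_trans tx)// ltrD2l.
have h2 : `|Ioo_int a b (fun t => W t * bump n y t) - W y| <= e / 3.
  apply: (Ioo_int_bump_near n0 (ltW (lt_trans ax xy)) (ltW s3)); first exact: bump_integrable.
  move=> t tab /andP[xt tx]; rewrite distrC; apply: D2 => /=.
  by rewrite distrC ger0_norm ?subr_ge0// ltrBlDl (le_lt_trans tx)// ltrD2l.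
have h3 : `|Ioo_int x y H - Ioo_int a b (fun t => H t * (ramp n x t - ramp n y t))| <= e / 3.
  by rewrite /n; near: k; exact: cv.
have E' : Ioo_int a b (fun t => W t * bump n x t) - Ioo_int a b (fun t => W t * bump n y t)
    = - Ioo_int a b (fun t => H t * (ramp n x t - ramp n y t)).
  rewrite -E -Ioo_intB; [|exact: bump_integrable|exact: bump_integrable].
  by apply: eq_Ioo_int => t _; rewrite mulrBr.
move: h1 h2 h3; rewrite !ler_norml => /andP[? ?] /andP[? ?] /andP[? ?].
apply/andP; split; lra.
Unshelve. all: by end_near. Qed.

End WeakFTC.

(** * Integration by parts in W22 *)

Section Product.
Context {R : realType}.
Implicit Types (a b x y c t s : R) (f g w : R -> R).

Lemma C1c_near0 a b t phi : C1c a b phi -> t \notin `]a, b[ -> \forall s \near t, phi s = 0.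
Proof.
move=> [_ _ _ sub] tab.
have op : open (~` closure [set x | phi x != 0]) by apply: closed_openC; exact: closed_closure.
have tn : (~` closure [set x | phi x != 0]) t by move=> /sub; rewrite /= (negbTE tab).
have : nbhs t (~` closure [set x | phi x != 0]) by apply: open_nbhs_nbhs; split.
apply: filterS => s /= hs; apply: contrapT => /eqP ps; apply: hs.
exact: subset_closure.
Qed.

(** The test function vanishes near every point outside the open interval, so the
    product is C^1 on the whole line whatever f does there. *)
Lemma C1c_mul a b f f' phi :
  (forall x, x \in `]a, b[ -> is_derive x 1 f (f' x)) ->
  (forall x, x \in `]a, b[ -> {for x, continuous f'}) -> C1c a b phi ->
  C1c a b (fun t => f t * phi t) /\
  forall t, t \in `]a, b[ -> derive1 (fun t => f t * phi t) t =
    f' t * phi t + f t * derive1 phi t.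
Proof.
move=> df cf' cphi; have [dphi cphi' kphi sphi] := cphi.
have inD t : t \in `]a, b[ ->
    is_derive t 1 (fun t => f t * phi t) (f' t * phi t + f t * derive1 phi t).
  move=> tab; have h1 := df _ tab.
  have h2 : is_derive t 1 phi (derive1 phi t).
    by rewrite derive1E; apply: derivableP; exact: dphi.
  have := is_deriveM h1 h2.
  by move/is_derive_eq; apply; rewrite /GRing.scale/= addrC [phi t * _]mulrC.
have inE t : t \in `]a, b[ ->
    derive1 (fun t => f t * phi t) t = f' t * phi t + f t * derive1 phi t.
  by move=> /inD [_ <-]; rewrite derive1E.
have outz t : t \notin `]a, b[ -> \forall s \near t, f s * phi s = 0.
  move=> tab; apply: filterS (C1c_near0 cphi tab) => s ->; exact: mulr0.
have zD t : (\forall s \near t, f s * phi s = 0) -> is_derive t 1 (fun t => f t * phi t) 0.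
  move=> h; apply: (@near_eq_is_derive _ _ _ (cst 0)).
  by apply: filterS h => s ->.
split; last exact: inE.
split.
- move=> t; have [tab|tab] := boolP (t \in `]a, b[).
    by have [] := inD _ tab.
  by have [] := zD _ (outz _ tab).
- move=> t; have [tab|tab] := boolP (t \in `]a, b[).
    rewrite /prop_for /continuous_at (inE _ tab).
    apply: (@cvg_trans _ ((fun t => f' t * phi t + f t * derive1 phi t) @ t)); last first.
      have k1 : f' s @[s --> t] --> f' t by exact: cf'.
      have k2 : phi s @[s --> t] --> phi t.
        by apply/differentiable_continuous/derivable1_diffP.
      have k3 : f s @[s --> t] --> f t.
        by apply/differentiable_continuous/derivable1_diffP; have [] := df _ tab.
      have k4 : derive1 phi s @[s --> t] --> derive1 phi t by exact: cphi'.
      exact: (cvgD (cvgM k1 k2) (cvgM k3 k4)).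
    apply: near_eq_cvg; near=> s; rewrite inE//.
    by near: s; exact: near_in_itvoo.
  have := outz _ tab => /near_join h.
  have z : derive1 (fun t => f t * phi t) t = 0.
    by rewrite derive1E; have [_] := zD _ (outz _ tab).
  rewrite /prop_for /continuous_at z.
  have k0 : (cst (0 : R)) s @[s --> t] --> (0 : R) by exact: cvg_cst.
  apply: cvg_trans k0.
  apply: near_eq_cvg; apply: filterS h => s hs.
  by rewrite derive1E; have [_ ->] := zD _ hs.
- apply: (subclosed_compact _ kphi); first exact: closed_closure.
  by apply: closure_subset => t /=; apply: contraNN => /eqP ->; rewrite mulr0.
- apply: subset_trans sphi.
  by apply: closure_subset => t /=; apply: contraNN => /eqP ->; rewrite mulr0.
Unshelve. all: by end_near. Qed.

Lemma within_continuous_at a b f t : {within `[a, b], continuous f} -> t \in `]a, b[ ->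
  {for t, continuous f}.
Proof.
move=> cf tab; have ab : a < b by move: tab; rewrite in_itv/= => /andP[/lt_trans]; apply.
by have [h _ _] := (continuous_within_itvP f ab).1 cf; apply: h; rewrite inE.
Qed.

Lemma within_continuousM a b f g : {within `[a, b], continuous f} ->
  {within `[a, b], continuous g} ->
  {within `[a, b], continuous (fun t => f t * g t)}.
Proof. by move=> cf cg x; apply: cvgM; [exact: cf|exact: cg]. Qed.

Lemma within_continuousD_fun a b f g : {within `[a, b], continuous f} ->
  {within `[a, b], continuous g} ->
  {within `[a, b], continuous (fun t => f t + g t)}.
Proof. by move=> cf cg x; apply: cvgD; [exact: cf|exact: cg]. Qed.

Lemma within_continuous_postcomp a b (G : R -> R) f : continuous G ->
  {within `[a, b], continuous f} ->
  {within `[a, b], continuous (fun t => G (f t))}.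
Proof. by move=> cG cf x; apply: (@continuous_comp (subspace `[a, b]%classic) R R f G x
  (cf x) (cG _)). Qed.

Lemma within_continuousS a b x y f : a <= x -> y <= b -> {within `[a, b], continuous f} ->
  {within `[x, y], continuous f}.
Proof.
move=> ax yb; apply: continuous_subspaceW; apply: subset_itv; by rewrite bnd_simp.
Qed.

Lemma C1c_within a b phi : C1c a b phi ->
  {within `[a, b], continuous phi} /\ {within `[a, b], continuous (derive1 phi)}.
Proof.
move=> [dphi cphi' _ _]; split; apply: continuous_subspaceT => // t.
by apply/differentiable_continuous/derivable1_diffP.
Qed.

(** Leibniz rule with a factor u of class C^1: u * phi is again a test function,
    and it is tested against the weak derivative of w. *)
Lemma weak_derivative_mul a b u v w g :
  C1_closed a b u v -> {within `[a, b], continuous w} -> Ioo_integrable a b g ->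
  weak_derivative a b w g ->
  weak_derivative a b (fun t => u t * w t) (fun t => v t * w t + u t * g t).
Proof.
move=> [cu cv du] cw ig wd phi cphi.
have [c1 c2] := C1c_within cphi.
have [C E] := C1c_mul du (fun t => within_continuous_at cv) cphi.
have := wd _ C.
rewrite (@eq_Ioo_int _ a b _ (fun t => (v t * w t) * phi t + (u t * w t) * derive1 phi t));
  last first.
  by move=> t tab; rewrite E//; ring.
rewrite Ioo_intD; last 2 first.
- by apply: Ioo_integrable_continuous; do 2 apply: within_continuousM => //.
- by apply: Ioo_integrable_continuous; do 2 apply: within_continuousM => //.
rewrite [X in _ = - X](@eq_Ioo_int _ a b _ (fun t => (u t * phi t) * g t)); last
  by move=> t _; ring.
move=> H.
rewrite [in RHS](@eq_Ioo_int _ a b _ (fun t => (v t * w t) * phi t + (u t * phi t) * g t));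
  last by move=> t _; ring.
rewrite Ioo_intD; last 2 first.
- by apply: Ioo_integrable_continuous; do 2 apply: within_continuousM => //.
- by apply: Ioo_integrable_continuousM => //; exact: within_continuousM.
lra.
Qed.

Lemma square_integrable_integrable a b f : square_integrable a b f -> Ioo_integrable a b f.
Proof.
move=> [mf sf]; apply: (Ioo_integrable_dominated (g := fun t => 1 + f t ^+ 2)) => //.
- by apply: Ioo_integrableD => //; exact: Ioo_integrable_cst.
- move=> t _; rewrite -(real_normK (num_real (f t))).
  have := normr_ge0 (f t); nra.
Qed.

Lemma square_integrable_sqr a b f : square_integrable a b f ->
  Ioo_integrable a b (fun t => f t ^+ 2).
Proof. by case. Qed.

Section W22facts.
Variables (a b : R) (u : W22 a b).
Notation w := (W22_d1 u).
Notation g := (W22_d2 u).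

Lemma W22_continuous : {within `[a, b], continuous u}. Proof. by case: (W22_C1 u). Qed.
Lemma W22_d1_continuous : {within `[a, b], continuous w}. Proof. by case: (W22_C1 u). Qed.
Lemma W22_is_derive x : x \in `]a, b[ -> is_derive x 1 u (w x). Proof.
  by case: (W22_C1 u) => _ _; apply. Qed.
Lemma W22_d2_integrable : Ioo_integrable a b g. Proof.
  exact/square_integrable_integrable/W22_L2_d2. Qed.
Lemma W22_d2_sqr_integrable : Ioo_integrable a b
  (fun t => g t ^+ 2). Proof. exact/square_integrable_sqr/W22_L2_d2. Qed.

Lemma W22_FTC x y : a < x -> x <= y -> y < b -> w y - w x = Ioo_int x y g.
Proof.
move=> ax xy yb; apply: (weak_derivative_FTC ax xy yb).
- by move=> t; exact: within_continuous_at W22_d1_continuous.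
- exact: Ioo_integrable_continuous W22_d1_continuous.
- exact: W22_d2_integrable.
- exact: W22_weak_d2.
Qed.

Lemma C1_closed_comp (G G' : R -> R) : (forall s, is_derive s 1 G (G' s)) -> continuous G' ->
  C1_closed a b (fun t => G (u t)) (fun t => G' (u t) * w t).
Proof.
move=> dG cG'; have cG : continuous G.
  by move=> s; apply/differentiable_continuous/derivable1_diffP; have [] := dG s.
split.
- exact: within_continuous_postcomp cG W22_continuous.
- by apply: within_continuousM W22_d1_continuous;
  exact: within_continuous_postcomp cG' W22_continuous.
- move=> x xab; have := @is_derive1_comp R G u x _ _ (dG _) (W22_is_derive xab).
  exact.
Qed.

(** G(u) u' has the integrable weak derivative G'(u) (u')^2 + G(u) u'' and is
    continuous, so the fundamental theorem of calculus applies to it. *)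
Lemma W22_by_parts (G G' : R -> R) x y : (forall s, is_derive s 1 G (G' s)) -> continuous G' ->
  a < x -> x <= y -> y < b ->
  G (u y) * w y - G (u x) * w x = Ioo_int x y (fun t => G' (u t) * w t ^+ 2 + G (u t) * g t).
Proof.
move=> dG cG' ax xy yb.
have C := C1_closed_comp dG cG'; have [c1 c2 _] := C.
have := @weak_derivative_FTC R a b x y _ _ ax xy yb _ _ _
  (weak_derivative_mul C W22_d1_continuous W22_d2_integrable (W22_weak_d2 u)).
move=> ->.
- by apply: eq_Ioo_int => t _; rewrite expr2 mulrA.
- by move=> t tab; apply: cvgM;
  [exact: within_continuous_at c1 tab|exact: within_continuous_at W22_d1_continuous tab].
- by apply: Ioo_integrable_continuous; apply: within_continuousM => //; exact: W22_d1_continuous.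
- apply: Ioo_integrableD; first
  by apply: Ioo_integrable_continuous; apply: within_continuousM => //; exact: W22_d1_continuous.
  by apply: Ioo_integrable_continuousM => //; exact: W22_d2_integrable.
Qed.

Lemma W22_holder_ordered x y : a < x -> x <= y -> y < b ->
  (w y - w x) ^+ 2 <= (y - x) * Ioo_int a b (fun t => g t ^+ 2).
Proof.
move=> ax; rewrite le_eqVlt => /predU1P[<- _|xy yb].
  by rewrite !subrr expr0n/= mul0r.
have [B BE] : exists B, B = Ioo_int a b (fun t => g t ^+ 2) by eexists.
rewrite -BE; have B0 : 0 <= B by rewrite BE; apply: Ioo_int_ge0 => t _; exact: sqr_ge0.
pose d := `|w y - w x|; have dE : d ^+ 2 = (w y - w x) ^+ 2 by rewrite real_normK ?num_real.
rewrite -dE; have yx : 0 < y - x by rewrite subr_gt0.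
have [->|dn0] := eqVneq d 0; first by rewrite expr0n/= mulr_ge0// ltW.
have d0 : 0 < d by rewrite lt_neqAle eq_sym dn0 normr_ge0.
have ig2 : Ioo_integrable x y (fun t => g t ^+ 2)
  by apply: Ioo_integrableS W22_d2_sqr_integrable; exact: ltW.
have igxy : Ioo_integrable x y g by apply: Ioo_integrableS W22_d2_integrable; exact: ltW.
(* s makes Young's inequality below as sharp as the Cauchy-Schwarz inequality *)
have [s s0 sE] : exists2 s : R, 0 < s & s * (y - x) = d.
  by exists (d / (y - x)); rewrite ?divr_gt0 ?divfK ?gt_eqF.
have H : d <= (s * (y - x) + s^-1 * B) / 2.
  rewrite /d (W22_FTC ax (ltW xy) yb).
  apply: (le_trans (Ioo_int_norm igxy)).
  apply: (@le_trans _ _ (Ioo_int x y (fun t => s / 2 + s^-1 / 2 * g t ^+ 2))).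
    apply: Ioo_int_le; [exact: Ioo_integrable_norm|apply: Ioo_integrableD;
      [exact: Ioo_integrable_cst|exact: Ioo_integrableZ]|].
    move=> t _; rewrite -(real_normK (num_real (g t))).
    set q := `|g t|.
    have -> : s / 2 + s^-1 / 2 * q ^+ 2 = q + (s - q) ^+ 2 / (2 * s).
      by field; rewrite gt_eqF.
    by rewrite lerDl divr_ge0 ?sqr_ge0// mulr_ge0// ltW.
  rewrite Ioo_intD; [|exact: Ioo_integrable_cst|exact: Ioo_integrableZ].
  rewrite (Ioo_int_cst _ (ltW xy)) Ioo_intZ//.
  have : Ioo_int x y (fun t => g t ^+ 2) <= B.
    by rewrite BE; apply: Ioo_int_subitv W22_d2_sqr_integrable _; rewrite ?ltW// => t _;
      exact: sqr_ge0.
  have sp : 0 < s^-1 by rewrite invr_gt0.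
  move: (Ioo_int x y (fun t => g t ^+ 2)) => I; rewrite -(ler_pM2l sp); lra.
have sd : s * d <= B by rewrite -ler_pdivlMl//; move: H; rewrite sE; lra.
have -> : d ^+ 2 = (y - x) * (s * d) by rewrite expr2 -{1}sE; ring.
by rewrite ler_pM2l.
Qed.

End W22facts.
End Product.

(** * Interpolation on windows and for monotone functions *)

Definition pm_sign {R : realType} (sg : R) := sg = 1 \/ sg = -1.

Section Monotone.
Context {R : realType}.
Implicit Types (x y p q l e t s : R).

Lemma continuous_le_closed (a b : R) (f : R -> R) c : a < b -> {within `[a, b], continuous f} ->
  (forall t, t \in `]a, b[ -> f t <= c) -> forall t, t \in `[a, b] -> f t <= c.
Proof.
move=> ab /(continuous_within_itvP _ ab) [_ fa fb] H t.
rewrite in_itv/= => /andP[]; rewrite le_eqVlt => /predU1P[<- _|at_].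
  apply: (cvgr_to_le fa); near=> s; apply: H; rewrite in_itv/=; apply/andP; split.
    by near: s; exact: nbhs_right_gt.
  by near: s; exact: nbhs_right_lt.
rewrite le_eqVlt => /predU1P[->|tb]; last by apply: H; rewrite in_itv/= at_.
apply: (cvgr_to_le fb); near=> s; apply: H; rewrite in_itv/=; apply/andP; split.
  by near: s; exact: nbhs_left_gt.
by near: s; exact: nbhs_left_lt.
Unshelve. all: by end_near. Qed.

Variables (a b : R) (u : W22 a b).
Hypothesis ab : a < b.
Notation w := (W22_d1 u).
Notation g := (W22_d2 u).
Notation A := (Ioo_int a b (fun t => w t ^+ 2)).
Notation B := (Ioo_int a b (fun t => g t ^+ 2)).
Notation Wt := (Ioo_int a b (fun t => double_well (u t))).

Lemma double_well_ge0 (s : R) : 0 <= double_well s.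
Proof. by rewrite divr_ge0 ?sqr_ge0. Qed.

Lemma continuous_double_well : continuous (@double_well R).
Proof.
move=> s; apply: cvgM; last exact: cvg_cst.
apply: (@continuous_comp _ _ _ (fun s : R => s ^+ 2 - 1) (fun s => s ^+ 2));
  last exact: exprn_continuous.
by apply: cvgB; [exact: exprn_continuous|exact: cvg_cst].
Qed.

Lemma W22_continuous_comp (G : R -> R) : continuous G ->
  {within `[a, b], continuous (fun t => G (u t))}.
Proof. by move=> cG; exact: (@within_continuous_postcomp R a b G u cG
  (@W22_continuous _ _ _ u)). Qed.

Lemma W22_d1_sqr_continuous : {within `[a, b], continuous (fun t => w t ^+ 2)}.
Proof. by apply: (@within_continuous_postcomp _ a b (fun s => s ^+ 2) w);
  [exact: exprn_continuous|exact: W22_d1_continuous]. Qed.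

Lemma W22_sqr_continuous : {within `[a, b], continuous (fun t => u t ^+ 2)}.
Proof. by apply: (@within_continuous_postcomp _ a b (fun s => s ^+ 2) u);
  [exact: exprn_continuous|exact: W22_continuous]. Qed.

Lemma W22_double_well_integrable : Ioo_integrable a b (fun t => double_well (u t)).
Proof. by apply: Ioo_integrable_continuous; apply: W22_continuous_comp;
  exact: continuous_double_well. Qed.

Lemma W22_d1_sqr_integrable : Ioo_integrable a b (fun t => w t ^+ 2).
Proof. by apply: Ioo_integrable_continuous; exact: W22_d1_sqr_continuous. Qed.

Lemma W22_holder l x y : x \in `]a, b[ -> y \in `]a, b[ -> `|x - y| <= l ->
  (w x - w y) ^+ 2 <= l * B.
Proof.
have B0 : 0 <= B by apply: Ioo_int_ge0 => t _; exact: sqr_ge0.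
wlog xy : x y / x <= y => [H xab yab xyl|].
  have [xy|/ltW yx] := leP x y; first exact: H.
  by rewrite -sqrrN opprB; apply: H => //; rewrite distrC.
rewrite !in_itv/= => /andP[ax xb] /andP[ay yb] xyl.
rewrite -sqrrN opprB (le_trans (W22_holder_ordered u ax xy yb))// ler_wpM2r//.
by rewrite -(@ger0_norm _ (y - x)) ?subr_ge0// distrC.
Qed.

Lemma W22_holder_closed x y : x \in `[a, b] -> y \in `[a, b] -> (w x - w y) ^+ 2 <= (b - a) * B.
Proof.
have c1 (z : R) : {within `[a, b], continuous (fun t => (w t - z) ^+ 2)}.
  apply: (@within_continuous_postcomp _ a b (fun s => (s - z) ^+ 2) w);
    last exact: W22_d1_continuous.
  move=> s; apply: (@continuous_comp _ _ _ (fun s : R => s - z) (fun s => s ^+ 2));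
    last exact: exprn_continuous.
  by apply: cvgB; [exact: cvg_id|exact: cvg_cst].
move=> xab yab; move: x xab; apply: continuous_le_closed => // x xab.
rewrite -sqrrN opprB; move: y yab; apply: continuous_le_closed => // y yab.
apply: W22_holder => //; move: xab yab; rewrite !in_itv/= => /andP[? ?] /andP[? ?].
by rewrite ler_norml; apply/andP; split; lra.
Qed.

(** There are points in the first and in the last third of the window at which u^2
    is, up to a constant, at most three times its mean.
    The mean value theorem gives a point in between where u' is controlled by u,
    and u'' transports this control over the window. *)
Lemma window_interpolation l p : 0 < l -> a <= p -> p + l <= b ->
  Ioo_int p (p + l) (fun t => w t ^+ 2) <=
  216 * Ioo_int p (p + l) (fun t => u t ^+ 2) / l ^+ 2 + 216 + 2 * l ^+ 2 * B.
Proof.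
move=> l0 ap pb.
have [S SE] : exists S, S = Ioo_int p (p + l) (fun t => u t ^+ 2) by eexists.
rewrite -SE.
have l20 : 0 < l ^+ 2 by rewrite exprn_gt0.
have iu : Ioo_integrable p (p + l) (fun t => u t ^+ 2).
  by apply: Ioo_integrableS (Ioo_integrable_continuous W22_sqr_continuous).
have near_avg x : p <= x -> x + l / 3 <= p + l ->
    exists2 t, t \in `]x, x + l / 3[ & u t ^+ 2 * (l / 3) <= S + l ^+ 2.
  move=> px xp.
  have xl : x < x + l / 3 by rewrite ltrDl divr_gt0.
  have [t tx Ht] := @exists_le_average _ x (x +
    l / 3) (fun t => u t ^+ 2) (l ^+ 2) xl l20 (Ioo_integrableS px xp iu).
  exists t => //; rewrite addrC addKr in Ht; apply: (le_trans Ht); rewrite lerD2r.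
  by rewrite SE; apply: Ioo_int_subitv => //; [exact: ltW|move=> s _; exact: sqr_ge0].
have [||x1 x1I H1] := near_avg p; [by []|lra|].
have [||x2 x2I H2] := near_avg (p + l / 3 + l / 3); [lra|lra|].
move: x1I x2I; rewrite !in_itv/= => /andP[x1a x1b] /andP[x2a x2b].
have x12 : x1 < x2 by lra.
have [||xi xiI mvt] := @MVT R u w x1 x2 x12.
- by move=> t; rewrite in_itv/= => /andP[? ?]; apply: W22_is_derive; rewrite in_itv/=;
  apply/andP; split; lra.
- by apply: within_continuousS (@W22_continuous _ _ _ u); lra.
move: xiI; rewrite in_itv/= => /andP[xi1 xi2].
have wxi : w xi ^+ 2 * l ^+ 3 <= 108 * (S + l ^+ 2).
  have d2 : l / 3 <= x2 - x1 by lra.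
  have e1 : w xi ^+ 2 * (l / 3) ^+ 2 <= (u x2 - u x1) ^+ 2.
    rewrite mvt [leRHS]exprMn ler_wpM2l ?sqr_ge0// ler_sqr ?nnegrE//; lra.
  have e2 : (u x2 - u x1) ^+ 2 <= 2 * u x1 ^+ 2 + 2 * u x2 ^+ 2.
    have := sqr_ge0 (u x2 + u x1); nra.
  have e3 : w xi ^+ 2 * (l / 3) ^+ 2 * (l / 3) <= (2 * u x1 ^+ 2 + 2 * u x2 ^+ 2) * (l / 3).
    by rewrite ler_wpM2r ?(le_trans e1)// divr_ge0// ltW.
  rewrite expr_div_n in e3; move: H1 H2 e3; move: (w xi ^+ 2) (u x1 ^+ 2) (u x2 ^+ 2) => q1 q2 q3.
  have -> : q1 * (l ^+ 2 / 3 ^+ 2) * (l / 3) = q1 * l ^+ 3 / 27 by field.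
  lra.
have H t : t \in `]p, p + l[ -> w t ^+ 2 <= 2 * w xi ^+ 2 + 2 * (l * B).
  rewrite in_itv/= => /andP[pt tp].
  have : (w t - w xi) ^+ 2 <= l * B.
    apply: W22_holder; rewrite ?in_itv/= ?ler_norml; apply/andP; split; lra.
  have := sqr_ge0 (w t - 2 * w xi); nra.
apply: (@le_trans _ _ (Ioo_int p (p + l) (fun=> 2 * w xi ^+ 2 + 2 * (l * B)))).
  apply: Ioo_int_le => //; [by apply: Ioo_integrableS W22_d1_sqr_integrable|
    exact: Ioo_integrable_cst].
rewrite Ioo_int_cst ?lerDl ?(ltW l0)// addrAC subrr add0r.
have l30 : 0 < l ^+ 3 by rewrite exprn_gt0.
have : w xi ^+ 2 <= 108 * (S + l ^+ 2) / l ^+ 3 by rewrite ler_pdivlMr.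
rewrite -(ler_pM2r l0) => e.
have -> : 216 * S / l ^+ 2 + 216 = 2 * (108 * (S + l ^+ 2) / l ^+ 3 * l).
  by field; rewrite gt_eqF.
lra.
Qed.

(** Some window of length l around x lies in the interval, and u' varies on it by
    at most the square root of l * B. *)
Lemma W22_d1_sup_bound l x : 0 < l -> 2 * l <= b - a -> x \in `]a, b[ ->
  l * w x ^+ 2 <= 2 * A + 2 * l ^+ 2 * B.
Proof.
move=> l0 lab; rewrite in_itv/= => /andP[ax xb].
have [p [ap pb px]] : exists p, [/\ a <= p, p + l <= b & p <= x <= p + l].
  have [h|h] := leP (x + l) b.
    by exists x; split; [lra|lra|apply/andP; split; lra].
  by exists (x - l); split; [lra|lra|apply/andP; split; lra].
move/andP: px => [px xp].
have H t : t \in `]p, p + l[ -> w x ^+ 2 <= 2 * w t ^+ 2 + 2 * (l * B).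
  rewrite in_itv/= => /andP[pt tp].
  have : (w x - w t) ^+ 2 <= l * B.
    apply: W22_holder; rewrite ?in_itv/= ?ler_norml; apply/andP; split; lra.
  have := sqr_ge0 (w x - 2 * w t); nra.
have ip : Ioo_integrable p (p + l) (fun t => w t ^+ 2)
  by apply: Ioo_integrableS W22_d1_sqr_integrable.
have ple : p <= p + l by lra.
have : Ioo_int p (p + l) (fun=> w x ^+ 2) <=
  Ioo_int p (p + l) (fun t => 2 * w t ^+ 2 + 2 * (l * B)).
  apply: Ioo_int_le => //; [exact: Ioo_integrable_cst|apply: Ioo_integrableD;
    [exact: Ioo_integrableZ|exact: Ioo_integrable_cst]].
rewrite Ioo_intD; [|exact: Ioo_integrableZ|exact: Ioo_integrable_cst].
rewrite Ioo_intZ// !(Ioo_int_cst _ ple) addrAC subrr add0r.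
have : Ioo_int p (p + l) (fun t => w t ^+ 2) <= A.
  by apply: Ioo_int_subitv W22_d1_sqr_integrable _ => // t _; exact: sqr_ge0.
move: (Ioo_int p (p + l) (fun t => w t ^+ 2)) A B => I A' B'; lra.
Qed.

(** multiplier N s = s - (1 + N^2) s / (s^2 + N^2). It behaves like s at infinity,
    vanishes at the two wells, and becomes negligible with respect to the square
    root of W as N grows. *)
Definition multiplier (N s : R) := s * (s ^+ 2 - 1) / (s ^+ 2 + N ^+ 2).
Definition multiplier' (N s : R) := 1 - (1 + N ^+ 2) * (N ^+ 2 - s ^+ 2) / (s ^+ 2 + N ^+ 2) ^+ 2.

Section Multiplier.
Variable N : R.
Hypothesis N1 : 1 <= N.

Let den_gt0 s : 0 < s ^+ 2 + N ^+ 2.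
Proof. by rewrite ltr_wpDl ?sqr_ge0// exprn_gt0// (lt_le_trans ltr01). Qed.

Lemma is_derive_multiplier s : is_derive s 1 (multiplier N) (multiplier' N s).
Proof.
have dn : is_derive s 1 (fun s : R => s * (s ^+ 2 - 1)) (3 * s ^+ 2 - 1).
  have -> : (fun s : R => s * (s ^+ 2 - 1)) = (id : R -> R) * ((id : R -> R) ^+ 2 - cst 1) by [].
  apply: is_derive_eq; rewrite /GRing.scale/= -[(_ - _) s]/(s ^+ 2 - 1); ring.
have dd : is_derive s 1 (fun s : R => s ^+ 2 + N ^+ 2) (2 * s).
  have -> : (fun s : R => s ^+ 2 + N ^+ 2) = (id : R -> R) ^+ 2 + cst (N ^+ 2) by [].
  apply: is_derive_eq; rewrite /GRing.scale/=; ring.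
have di := @is_deriveV R (fun s : R => s ^+ 2 + N ^+ 2) s _ 1 (lt0r_neq0 (den_gt0 s)) dd.
have := is_deriveM dn di.
move/is_derive_eq; apply; rewrite /multiplier' /GRing.scale/=.
field; exact: lt0r_neq0.
Qed.

Lemma continuous_multiplier' : continuous (multiplier' N).
Proof.
move=> s; apply: cvgB; first exact: cvg_cst.
apply: cvgM.
  apply: cvgM; first exact: cvg_cst.
  by apply: cvgB; [exact: cvg_cst|exact: exprn_continuous].
apply: cvgV; first by rewrite expf_eq0/= lt0r_neq0.
apply: (@continuous_comp _ _ _ (fun s : R => s ^+ 2 + N ^+ 2) (fun s => s ^+ 2));
  last exact: exprn_continuous.
by apply: cvgD; [exact: exprn_continuous|exact: cvg_cst].
Qed.

(** The defect of the derivative with respect to 1 is integrable in s. *)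
Lemma multiplier'_ge s : 1 - (1 + N ^+ 2) * (1 + s ^+ 2)^-1 <= multiplier' N s.
Proof.
rewrite lerD2l lerNl opprK -mulrA ler_wpM2l ?addr_ge0 ?sqr_ge0//.
rewrite ler_pdivrMr ?exprn_gt0// mulrC ler_pdivlMr; last first.
  by rewrite ltr_pwDl ?sqr_ge0.
have := sqr_ge0 s; have : 1 <= N ^+ 2 by rewrite expr_ge1 ?(le_trans ler01).
move: (N ^+ 2) (s ^+ 2) => n q; nra.
Qed.

Lemma multiplier_le s : `|multiplier N s| <= `|s|.
Proof.
rewrite /multiplier -mulrA normrM -[leRHS]mulr1 ler_wpM2l// normrM normfV.
rewrite [X in _ / X]gtr0_norm// ler_pdivrMr// mul1r ler_norml.
have := sqr_ge0 s; have : 1 <= N ^+ 2 by rewrite expr_ge1 ?(le_trans ler01).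
move: (N ^+ 2) (s ^+ 2) => n q ? ?; apply/andP; split; lra.
Qed.

(** Up to sign (s^2 - 1) / 2 is the square root of W(s), and |s| / (s^2 + N^2) is at
    most 1 / (2 N). *)
Lemma multiplier_mul_le s t : `|multiplier N s * t| <= (double_well s + t ^+ 2) / (2 * N).
Proof.
have N0 : 0 < N by rewrite (lt_le_trans ltr01).
have h : `|multiplier N s| <= `|s ^+ 2 - 1| / (2 * N).
  rewrite /multiplier mulrAC normrM mulrC ler_wpM2l// normrM normfV [X in _ / X]gtr0_norm//.
  rewrite ler_pdivrMr// ler_pdivlMl ?mulr_gt0//.
  rewrite -[s ^+ 2](real_normK (num_real s)); have := sqr_ge0 (`|s| - N); nra.
rewrite normrM (le_trans (ler_wpM2r (normr_ge0 t) h))// mulrAC ler_pM2r ?invr_gt0 ?mulr_gt0//.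
rewrite /double_well -(real_normK (num_real t)) -(real_normK (num_real (s ^+ 2 - 1))).
have := sqr_ge0 (`|s ^+ 2 - 1| / 2 - `|t|); lra.
Qed.

(** Integrate G'(u) (u')^2 by parts, for the multiplier G. What is missing from
    G' = 1 is at most (1 + N^2) (u')^2 / (1 + u^2); one factor u' is bounded by P,
    and the integral of |u'| / (1 + u^2) by pi because u is monotone. *)
Lemma monotone_inner_bound (sg p q P : R) : pm_sign sg ->
  (forall t, t \in `]a, b[ -> 0 <= sg * w t) ->
  (forall t, t \in `]a, b[ -> `|w t| <= P) -> 0 <= P ->
  a < p -> p <= q -> q < b ->
  Ioo_int p q (fun t => w t ^+ 2) <=
  `|u p * w p| + `|u q * w q| + (Wt + B) / (2 * N) + (1 + N ^+ 2) * pi * P.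
Proof.
move=> sgE sw wP P0 ap pq qb.
have N0 : 0 < N by rewrite (lt_le_trans ltr01).
have inab t : t \in `]p, q[ -> t \in `]a, b[.
  by rewrite !in_itv/= => /andP[? ?]; apply/andP; split; lra.
have cq (f : R -> R) : {within `[a, b], continuous f} -> {within `[p, q], continuous f}.
  exact: within_continuousS (ltW ap) (ltW qb).
have iq (f : R -> R) : Ioo_integrable a b f -> Ioo_integrable p q f
  by exact: (@Ioo_integrableS R a b p q f (ltW ap) (ltW qb)).
(* the derivative of atan (u), whose integral is at most pi in absolute value *)
pose ta t := (1 + (u t) ^+ 2)^-1 * w t.
have cinv : continuous (fun s : R => (1 + s ^+ 2)^-1).
  move=> s; apply: cvgV; first by rewrite gt_eqF// ltr_pwDl ?sqr_ge0.
  by apply: cvgD; [exact: cvg_cst|exact: exprn_continuous].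
have [ca1 ca2 ca3] := C1_closed_comp u (@is_derive1_atan R) cinv.
have ita : Ioo_int p q ta = atan (u q) - atan (u p).
  have ca2' := cq ta ca2.
  have ca1' := cq (fun t => atan (u t)) ca1.
  have ca3' t : t \in `]p, q[ -> is_derive t 1 (fun t => atan (u t)) (ta t).
    by move=> /inab; exact: ca3.
  pose proof (@Ioo_int_FTC2 R p q ta (fun t => atan (u t)) pq ca2' ca1' ca3') as X.
  rewrite X; by [].
have ipi : Ioo_int p q (fun t => sg * ta t) <= pi.
  rewrite Ioo_intZ; last by apply: iq; exact: Ioo_integrable_continuous.
  rewrite ita.
  have := atan_gtNpi2 (u p); have := atan_ltpi2 (u p).
  have := atan_gtNpi2 (u q); have := atan_ltpi2 (u q).
  by case: sgE => ->; lra.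
have parts := W22_by_parts u is_derive_multiplier continuous_multiplier' ap pq qb.
have bd t : `|multiplier N (u t) * w t| <= `|u t * w t|.
  rewrite (normrM (multiplier N (u t))) (normrM (u t)).
  by apply: ler_wpM2r => //; exact: multiplier_le.
have c2 : 0 <= 1 + N ^+ 2 by rewrite addr_ge0 ?sqr_ge0.
have iF : Ioo_integrable p q (fun t => multiplier' N (u t) * w t ^+ 2 + multiplier N (u t) * g t).
  apply: iq; apply: Ioo_integrableD.
    apply: Ioo_integrable_continuous; apply: within_continuousM;
      last exact: W22_d1_sqr_continuous.
    exact: W22_continuous_comp continuous_multiplier'.
  apply: Ioo_integrable_continuousM; last exact: W22_d2_integrable.
  apply: W22_continuous_comp => s; apply/differentiable_continuous/derivable1_diffP.
  by have [] := is_derive_multiplier s.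
have iE : Ioo_integrable p q (fun t => (2 * N)^-1 * (double_well (u t) + g t ^+ 2)).
  by apply: iq; apply: Ioo_integrableZ; apply: Ioo_integrableD;
    [exact: W22_double_well_integrable|exact: W22_d2_sqr_integrable].
have iT : Ioo_integrable p q (fun t => ((1 + N ^+ 2) * P) * (sg * ta t)).
  by apply: iq; do 2 apply: Ioo_integrableZ; exact: Ioo_integrable_continuous.
have main : Ioo_int p q (fun t => w t ^+ 2) <= Ioo_int p q (fun t =>
    (multiplier' N (u t) * w t ^+ 2 + multiplier N (u t) * g t)
    + (2 * N)^-1 * (double_well (u t) + g t ^+ 2) + ((1 + N ^+ 2) * P) * (sg * ta t)).
  apply: Ioo_int_le; [by apply: iq;
    exact: W22_d1_sqr_integrable|by apply: Ioo_integrableD => //; exact: Ioo_integrableD|].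
  move=> t tpq.
  have := multiplier_mul_le (u t) (g t); rewrite ler_norml => /andP[h1 _].
  have h2 : (1 - (1 + N ^+ 2) * (1 + u t ^+ 2)^-1) * w t ^+ 2 <= multiplier' N (u t) * w t ^+ 2.
    by rewrite ler_wpM2r ?sqr_ge0// multiplier'_ge.
  have d0 : 0 <= (1 + u t ^+ 2)^-1 by rewrite invr_ge0 addr_ge0 ?sqr_ge0.
  have h3 : w t ^+ 2 <= P * (sg * w t).
    have -> : w t ^+ 2 = `|w t| * (sg * w t).
      have := sw _ (inab _ tpq).
      by case: sgE => ->; rewrite ?mul1r ?mulN1r;
        [move/ger0_norm ->|rewrite oppr_ge0 => /ler0_norm ->]; ring.
    by rewrite ler_wpM2r ?sw ?wP// inab.
  have h4 : (1 + N ^+ 2) * (1 + u t ^+ 2)^-1 * w t ^+ 2 <=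
    (1 + N ^+ 2) * (1 + u t ^+ 2)^-1 * (P * (sg * w t)).
    by rewrite ler_wpM2l// mulr_ge0.
  rewrite /ta; lra.
rewrite Ioo_intD// in main; last exact: Ioo_integrableD.
rewrite Ioo_intD// in main.
rewrite -parts in main.
have E1 : Ioo_int p q (fun t => (2 * N)^-1 * (double_well (u t) + g t ^+ 2)) <=
  (Wt + B) / (2 * N).
  rewrite mulrC -[leRHS]mulrC -Ioo_intD;
    [|exact: W22_double_well_integrable|exact: W22_d2_sqr_integrable].
  rewrite -Ioo_intZ; last by apply: Ioo_integrableD;
    [exact: W22_double_well_integrable|exact: W22_d2_sqr_integrable].
  apply: Ioo_int_subitv; rewrite ?(ltW ap) ?(ltW qb)//.
    by apply: Ioo_integrableZ; apply: Ioo_integrableD;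
      [exact: W22_double_well_integrable|exact: W22_d2_sqr_integrable].
  move=> t _; rewrite mulr_ge0 ?invr_ge0 ?mulr_ge0 ?(ltW N0)//.
  by rewrite addr_ge0 ?double_well_ge0 ?sqr_ge0.
have E2 : Ioo_int p q (fun t => ((1 + N ^+ 2) * P) * (sg * ta t)) <= (1 + N ^+ 2) * pi * P.
  rewrite Ioo_intZ; last by apply: iq; apply: Ioo_integrableZ; exact: Ioo_integrable_continuous.
  rewrite [leRHS](_ : _ = (1 + N ^+ 2) * P * pi); last by ring.
  by apply: ler_wpM2l => //; rewrite mulr_ge0.
have := bd p; rewrite ler_norml => /andP[k1 _].
have := bd q; rewrite ler_norml => /andP[_ k2].
apply: (le_trans main).
lra.
Qed.
End Multiplier.

End Monotone.

(** * The interpolation inequality for monotone functions *)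

Section MonotoneBound.
Context {R : realType}.
Implicit Types (x y p q l e t s d : R).

Lemma double_well_coercive d s : 0 < d -> s ^+ 2 <= d * double_well s + (1 + d^-1).
Proof.
move=> d0; rewrite /double_well.
have -> : d * ((s ^+ 2 - 1) ^+ 2 / 4) + (1 + d^-1) =
  s ^+ 2 + (d * (s ^+ 2 - 1) - 2) ^+ 2 / (4 * d).
  by field; exact: lt0r_neq0.
by rewrite lerDl divr_ge0 ?sqr_ge0// mulr_ge0// ltW.
Qed.

(** The terms A / 8 on the right-hand side, three in all, are absorbed on the left.
    Here L stands for l^2 B, s for a bound on the integrals of u^2 over the windows
    divided by l^2, and i1, i2, i3 for the three parts of A. *)
Lemma collect_terms (vp vq s c n L A u1 u2 w1 w2 i1 i2 i3 : R) :
  A = i1 + (i2 + i3) ->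
  i2 <= vp + vq + n / 2 + ((A + L) / 8 + 4 * c) ->
  i1 <= w1 -> i3 <= w2 -> u1 <= s -> u2 <= s -> 0 <= s -> 0 <= n -> 0 <= c -> 0 <= L ->
  vp <= 2 * u1 + w1 / 8 + 1 -> vq <= 2 * u2 + w2 / 8 + 1 ->
  w1 <= 216 * u1 + 216 + 2 * L -> w2 <= 216 * u2 + 216 + 2 * L ->
  w1 <= A -> w2 <= A ->
  A <= 700 * s + 7 * L + n + (695 + 7 * c).
Proof. lra. Qed.

Section OneInterval.
Variables (a b : R) (u : W22 a b).
Hypothesis ab : a < b.
Notation w := (W22_d1 u).
Notation g := (W22_d2 u).
Notation A := (Ioo_int a b (fun t => w t ^+ 2)).
Notation B := (Ioo_int a b (fun t => g t ^+ 2)).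
Notation Wt := (Ioo_int a b (fun t => double_well (u t))).

Lemma window_sqr_le d l p : 0 < d -> 0 < l -> a <= p -> p + l <= b ->
  Ioo_int p (p + l) (fun t => u t ^+ 2) <= d * Wt + l * (1 + d^-1).
Proof.
move=> d0 l0 ap pb.
have ple : p <= p + l by lra.
have iW : Ioo_integrable p (p + l) (fun t => double_well (u t))
  by apply: Ioo_integrableS (W22_double_well_integrable u).
apply: (@le_trans _ _ (Ioo_int p (p + l) (fun t => d * double_well (u t) + (1 + d^-1)))).
  apply: Ioo_int_le.
  - by apply: Ioo_integrableS (Ioo_integrable_continuous (W22_sqr_continuous (u := u))).
  - by apply: Ioo_integrableD; [exact: Ioo_integrableZ|exact: Ioo_integrable_cst].
  - by move=> t _; exact: double_well_coercive.
rewrite Ioo_intD; [|exact: Ioo_integrableZ|exact: Ioo_integrable_cst].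
rewrite Ioo_intZ// (Ioo_int_cst _ ple) addrAC subrr add0r [_ * l]mulrC lerD2r ler_wpM2l ?(ltW
  d0)//.
by apply: Ioo_int_subitv (W22_double_well_integrable u) _ => // t _; exact: double_well_ge0.
Qed.

(** The integration by parts needs control of u u' at its end points. This fails in
    general at the ends of the interval, but holds at a point where a weighted sum
    of u^2 and (u')^2 is below its mean. *)
Lemma window_trace l p : 0 < l -> a <= p -> p + l <= b ->
  exists2 t, t \in `]p, p + l[ &
    `|u t * w t| <= 2 * Ioo_int p (p + l) (fun t => u t ^+ 2) / l ^+ 2
                   + Ioo_int p (p + l) (fun t => w t ^+ 2) / 8 + 1.
Proof.
move=> l0 ap pb.
have iu : Ioo_integrable p (p + l) (fun t => u t ^+ 2)
  by apply: Ioo_integrableS (Ioo_integrable_continuous (W22_sqr_continuous (u := u))).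
have iw : Ioo_integrable p (p + l) (fun t => w t ^+ 2)
  by apply: Ioo_integrableS (W22_d1_sqr_integrable u).
have pl : p < p + l by lra.
have i1 : Ioo_integrable p (p + l) (fun t => 2 / l * u t ^+ 2) by exact: Ioo_integrableZ.
have i2 : Ioo_integrable p (p + l) (fun t => l / 8 * w t ^+ 2) by exact: Ioo_integrableZ.
have [t tI] := exists_le_average pl l0 (Ioo_integrableD i1 i2).
rewrite Ioo_intD// !Ioo_intZ// addrAC subrr add0r => H; exists t => //.
have h : `|u t * w t| <= 2 / l * u t ^+ 2 + l / 8 * w t ^+ 2.
  rewrite normrM -(real_normK (num_real (u t))) -(real_normK (num_real (w t))).
  have -> : 2 / l * `|u t| ^+ 2 + l / 8 * `|w t| ^+ 2 =
    `|u t| * `|w t| + (4 * `|u t| - l * `|w t|) ^+ 2 / (8 * l) by field; exact: lt0r_neq0.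
  by rewrite lerDl divr_ge0 ?sqr_ge0// mulr_ge0// ltW.
apply: (le_trans h); rewrite -(ler_pM2r l0) (le_trans H)//.
rewrite le_eqVlt; apply/orP; left; apply/eqP; field; exact: lt0r_neq0.
Qed.

(** Split the interval at the points given by window_trace in the two end windows.
    The outer parts are bounded by window_interpolation and the inner part by
    monotone_inner_bound. *)
Lemma monotone_long_bound (sg l N d : R) : pm_sign sg ->
  (forall t, t \in `]a, b[ -> 0 <= sg * w t) ->
  0 < l -> 2 * l <= b - a -> 1 <= N -> 0 < d ->
  A <= 700 / l ^+ 2 * (d * Wt + l * (1 + d^-1)) + 7 * l ^+ 2 * B + (Wt + B) / N
       + (695 + 7 * ((1 + N ^+ 2) * pi) ^+ 2 / l).
Proof.
move=> sgE sw l0 lab N1 d0.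
have N0 : 0 < N by lra.
have l20 : 0 < l ^+ 2 by rewrite exprn_gt0.
have pi0 := pi_gt0 R.
have [c cE] : exists c, c = (1 + N ^+ 2) * pi :> R by eexists.
have c0 : 0 < c by rewrite cE mulr_gt0// ltr_pwDl ?sqr_ge0.
rewrite -cE.
have pb1 : a + l <= b by lra.
have pa2 : a <= b - l by lra.
have pb2 : (b - l) + l <= b by lra.
have [p pI Hp] := window_trace l0 (lexx a) pb1.
have [q qI Hq] := window_trace l0 pa2 pb2.
have S1 := window_sqr_le d0 l0 (lexx a) pb1.
have S2 := window_sqr_le d0 l0 pa2 pb2.
have W1 := window_interpolation u l0 (lexx a) pb1.
have W2 := window_interpolation u l0 pa2 pb2.
have iw2 := W22_d1_sqr_integrable u.
have w2 t : t \in `]a, b[ -> 0 <= w t ^+ 2 by move=> _; exact: sqr_ge0.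
have A1A : Ioo_int a (a + l) (fun t => w t ^+ 2) <= A
  by apply: Ioo_int_subitv iw2 w2; clear -l0 lab; lra.
have A2A : Ioo_int (b - l) (b - l + l) (fun t => w t ^+ 2) <= A
  by apply: Ioo_int_subitv iw2 w2; clear -l0 lab; lra.
have A0 : 0 <= A by apply: Ioo_int_ge0 => t _; exact: sqr_ge0.
have B0 : 0 <= B by apply: Ioo_int_ge0 => t _; exact: sqr_ge0.
have Wt0 : 0 <= Wt by apply: Ioo_int_ge0 => t _; exact: double_well_ge0.
have sup t : t \in `]a, b[ -> l * w t ^+ 2 <= 2 * A + 2 * l ^+ 2 * B by exact: W22_d1_sup_bound.
(* The weights of Young's inequality are such that c * P contains only A / 8. *)
have [P PE] : exists P, P = (A + l ^+ 2 * B) / (8 * c) + 4 * c / l :> R by eexists.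
have wP t : t \in `]a, b[ -> `|w t| <= P.
  move=> /sup; rewrite -(real_normK (num_real (w t))) PE => H.
  have H' : l * `|w t| ^+ 2 / (16 * c) + 4 * c / l <= (A + l ^+ 2 * B) / (8 * c) + 4 * c / l.
    rewrite lerD2r ler_pdivlMr ?mulr_gt0//.
    have -> : l * `|w t| ^+ 2 / (16 * c) * (8 * c) = l * `|w t| ^+ 2 / 2.
      by field; exact: lt0r_neq0.
    clear -H; lra.
  apply: le_trans H'.
  have -> : l * `|w t| ^+ 2 / (16 * c) + 4 * c / l =
      `|w t| + (l * `|w t| - 8 * c) ^+ 2 / (16 * c * l).
    by field; rewrite !lt0r_neq0.
  by rewrite lerDl divr_ge0 ?sqr_ge0// !mulr_ge0// ltW.
have P0 : 0 <= P.
  rewrite PE addr_ge0// divr_ge0 ?addr_ge0 ?mulr_ge0// ?ltW//.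
move: pI qI; rewrite !in_itv/= => /andP[ap pa] /andP[bq qb].
have pq : p <= q by clear -pa bq lab; lra.
have qb' : q < b by clear -qb; lra.
have M := monotone_inner_bound N1 sgE sw wP P0 ap pq qb'.
have cP : c * P = (A + l ^+ 2 * B) / 8 + 4 * c ^+ 2 / l.
  by rewrite PE; field; rewrite !lt0r_neq0.
rewrite -cE cP in M.
have split1 : A = Ioo_int a p (fun t => w t ^+ 2) + (Ioo_int p q (fun t => w t ^+ 2) +
  Ioo_int q b (fun t => w t ^+ 2)).
  have pleb : p <= b by clear -pq qb'; lra.
  rewrite (Ioo_int_split (ltW ap) pleb iw2).
  by rewrite (Ioo_int_split pq (ltW qb') (Ioo_integrableS (ltW ap) (lexx b) iw2)).
have K1 : Ioo_int a p (fun t => w t ^+ 2) <= Ioo_int a (a + l) (fun t => w t ^+ 2).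
  apply: (Ioo_int_subitv (lexx a) (ltW ap) (ltW pa)); first exact: Ioo_integrableS iw2.
  by move=> t _; exact: sqr_ge0.
have K2 : Ioo_int q b (fun t => w t ^+ 2) <= Ioo_int (b - l) (b - l + l) (fun t => w t ^+ 2).
  rewrite subrK; apply: (Ioo_int_subitv (ltW bq) (ltW qb') (lexx b));
    first exact: Ioo_integrableS iw2.
  by move=> t _; exact: sqr_ge0.
have [s sE] : exists s, s = d * Wt + l * (1 + d^-1) by eexists.
rewrite -sE in S1 S2 *.
have il2 : 0 < (l ^+ 2)^-1 by rewrite invr_gt0.
have T1 : Ioo_int a (a + l) (fun t => u t ^+ 2) / l ^+ 2 <= s / l ^+ 2 by rewrite ler_pM2r.
have T2 : Ioo_int (b - l) (b - l + l) (fun t => u t ^+ 2) / l ^+ 2 <= s / l ^+ 2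
  by rewrite ler_pM2r.
have s0 : 0 <= s.
  rewrite sE addr_ge0 ?mulr_ge0//; try exact: ltW.
  by rewrite addr_ge0// invr_ge0 ltW.
have s0' : 0 <= s / l ^+ 2 by rewrite divr_ge0// ltW.
have N2 : (Wt + B) / (2 * N) = (Wt + B) / N / 2 by field; exact: lt0r_neq0.
have N3 : 0 <= (Wt + B) / N by rewrite divr_ge0 ?addr_ge0// ltW.
have c2 : 0 <= c ^+ 2 / l by rewrite divr_ge0 ?sqr_ge0// ltW.
rewrite N2 in M.
have LB : 0 <= l ^+ 2 * B by rewrite mulr_ge0// ltW.
have sD x y : x * y / l ^+ 2 = x * (y / l ^+ 2) by rewrite mulrA.
have sC : 700 / l ^+ 2 * s = 700 * (s / l ^+ 2) by ring.
have cC : 4 * c ^+ 2 / l = 4 * (c ^+ 2 / l) by rewrite mulrA.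
have cC7 : 7 * c ^+ 2 / l = 7 * (c ^+ 2 / l) by rewrite mulrA.
have lB : 2 * l ^+ 2 * B = 2 * (l ^+ 2 * B) by rewrite mulrA.
have lB7 : 7 * l ^+ 2 * B = 7 * (l ^+ 2 * B) by rewrite mulrA.
rewrite sC cC7 lB7.
rewrite !sD in Hp Hq; rewrite sD lB in W1; rewrite sD lB in W2; rewrite cC in M.
move: split1 M K1 K2 T1 T2 s0' N3 c2 LB Hp Hq W1 W2 A1A A2A.
move: (Ioo_int a p (fun t => w t ^+ 2)) (Ioo_int p q (fun t => w t ^+ 2)) (Ioo_int q b
  (fun t => w t ^+ 2)).
move: (Ioo_int a (a + l) (fun t => w t ^+ 2)) (Ioo_int (b - l) (b - l + l) (fun t => w t ^+ 2)).
move: (Ioo_int a (a + l) (fun t => u t ^+ 2) / l ^+ 2) (Ioo_int (b - l) (b - l +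
  l) (fun t => u t ^+ 2) / l ^+ 2).
move: (s / l ^+ 2) (c ^+ 2 / l) ((Wt + B) / N) (l ^+ 2 * B) A.
move: (`|u p * w p|) (`|u q * w q|).
exact: collect_terms.
Qed.

End OneInterval.
End MonotoneBound.

Section MonotoneK.
Context {R : realType}.

Definition monotone_estimate (K C : R) :=
  forall (a b : R) (u : W22 a b) (sg z : R), a < b -> pm_sign sg ->
  (forall t, t \in `]a, b[ -> 0 <= sg * W22_d1 u t) ->
  z \in `[a, b] -> W22_d1 u z = 0 ->
  K * Ioo_int a b (fun t => W22_d1 u t ^+ 2) <=
  Ioo_int a b (fun t => double_well (u t)) + Ioo_int a b (fun t => W22_d2 u t ^+ 2) + C.

Lemma short_bound (a b : R) (u : W22 a b) z : a < b -> z \in `[a, b] -> W22_d1 u z = 0 ->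
  Ioo_int a b (fun t => W22_d1 u t ^+ 2) <= (b - a) ^+ 2 * Ioo_int a b (fun t => W22_d2 u t ^+ 2).
Proof.
move=> ab zab wz0.
pose B := Ioo_int a b (fun t => W22_d2 u t ^+ 2); rewrite -/B.
apply: (@le_trans _ _ (Ioo_int a b (fun=> (b - a) * B))).
  apply: Ioo_int_le; [exact: W22_d1_sqr_integrable|exact: Ioo_integrable_cst|] => t tab.
  have tab' : t \in `[a, b] by apply: subset_itv_oo_cc.
  by have := W22_holder_closed u ab tab' zab; rewrite wz0 subr0.
by rewrite (Ioo_int_cst _ (ltW ab)) mulrAC -expr2.
Qed.

(** The parameters of monotone_long_bound are chosen in the order l, N, d, to make the
    total coefficient of each part of the energy at most 1 / K. Intervals shorter
    than 2 l are covered by the trivial estimate short_bound. *)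
Lemma monotone_bound (K : R) : 0 < K -> exists2 C : R, 0 <= C & monotone_estimate K C.
Proof.
move=> K0.
have [l [l0 l1 Kl]] : exists l : R, [/\ 0 < l, l <= 1 & K * l <= 21^-1].
  exists (21 * K + 1)^-1; have h : 0 < 21 * K + 1 by lra.
  split; first by rewrite invr_gt0.
    by rewrite invf_le1//; lra.
  by rewrite ler_pdivrMr//; lra.
have l20 : 0 < l ^+ 2 by rewrite exprn_gt0.
have l2l : l ^+ 2 <= l by rewrite expr2 ler_piMl// ltW.
have Kl2 : K * l ^+ 2 <= 21^-1 by apply: le_trans Kl; rewrite ler_pM2l.
pose N := 3 * K + 1.
have [d [d0 Kd]] : exists d : R, 0 < d /\ K * (700 / l ^+ 2 * d) = 3^-1.
  have : 0 < 700 / l ^+ 2 by apply: divr_gt0; [rewrite ltr0n|exact: l20].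
  move: (700 / l ^+ 2) => X X0; exists (3 * K * X)^-1.
  split; first by rewrite invr_gt0 !mulr_gt0.
  by field; rewrite !lt0r_neq0.
have N1 : 1 <= N by rewrite /N; lra.
have N0 : 0 < N by apply: lt_le_trans N1.
have KN : K / N <= 3^-1 by rewrite ler_pdivrMr// /N; lra.
pose C0 := 700 / l ^+ 2 * (l * (1 + d^-1)) + (695 + 7 * ((1 + N ^+ 2) * pi) ^+ 2 / l).
have C00 : 0 <= C0.
  have dV : 0 <= 1 + d^-1 by rewrite addr_ge0// invr_ge0 ltW.
  apply: addr_ge0; first by apply: mulr_ge0; [apply: divr_ge0;
    [exact: ler0n|exact: ltW]|apply: mulr_ge0 => //; exact: ltW].
  apply: addr_ge0; first exact: ler0n.
  by apply: divr_ge0; [apply: mulr_ge0; [exact: ler0n|exact: sqr_ge0]|exact: ltW].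
exists (K * C0); first by rewrite mulr_ge0// ltW.
move=> a b u sg z ab sgE sw zab wz.
have W0 : 0 <= Ioo_int a b (fun t => double_well (u t))
  by apply: Ioo_int_ge0 => t _; exact: double_well_ge0.
have B0 : 0 <= Ioo_int a b (fun t => W22_d2 u t ^+ 2)
  by apply: Ioo_int_ge0 => t _; exact: sqr_ge0.
have KC : 0 <= K * C0 by rewrite mulr_ge0// ltW.
have [lab|lab] := leP (2 * l) (b - a).
  have := monotone_long_bound sgE sw l0 lab N1 d0.
  rewrite -(ler_pM2l K0) => H; apply: (le_trans H).
  rewrite /C0.
  move: W0 B0 Kd Kl2 KN.
  move: (Ioo_int a b (fun t => double_well (u t))) (Ioo_int a b
    (fun t => W22_d2 u t ^+ 2)) => W B W0 B0 Kd Kl2 KN.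
  have e1 : K * (700 / l ^+ 2 * (d * W + l * (1 + d^-1)) + 7 * l ^+ 2 * B + (W + B) / N
       + (695 + 7 * ((1 + N ^+ 2) * pi) ^+ 2 / l)) =
     K * (700 / l ^+ 2 * d) * W + 7 * (K * l ^+ 2 * B) + K / N * (W + B) +
     K * (700 / l ^+ 2 * (l * (1 + d^-1)) + (695 + 7 * ((1 + N ^+ 2) * pi) ^+ 2 / l)).
    by ring.
  rewrite e1 lerD2r Kd.
  have e2 : K * l ^+ 2 * B <= 21^-1 * B by rewrite ler_wpM2r.
  have e3 : K / N * (W + B) <= 3^-1 * (W + B) by rewrite ler_wpM2r// addr_ge0.
  move: (K * l ^+ 2 * B) (K / N * (W + B)) e2 e3 => x y; clear -W0 B0; lra.
have := short_bound ab zab wz.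
rewrite -(ler_pM2l K0) => H; apply: (le_trans H).
have h : K * ((b - a) ^+ 2 * Ioo_int a b (fun t => W22_d2 u t ^+ 2)) <=
  Ioo_int a b (fun t => W22_d2 u t ^+ 2).
  rewrite mulrA -[leRHS]mul1r ler_wpM2r//.
  have h1 : (b - a) ^+ 2 <= 4 * l ^+ 2.
    have -> : 4 * l ^+ 2 = (2 * l) ^+ 2 by ring.
    by rewrite ler_sqr ?nnegrE ?subr_ge0 ?ltW// mulr_gt0.
  rewrite (le_trans (ler_wpM2l (ltW K0) h1))// mulrCA; clear -Kl2; lra.
by rewrite (le_trans h)// addrAC lerDr addr_ge0.
Qed.

End MonotoneK.

(** * Blow-up *)

Section Rescale.
Context {R : realType}.
Variables (a b c e L : R).
Hypotheses (e0 : 0 < e) (L0 : 0 < L) (ac : a <= c + e * - L) (cb : c + e * L <= b).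
Implicit Types (f h phi : R -> R).

Let inab t : t \in `[- L, L] -> c + e * t \in `[a, b].
Proof.
rewrite !in_itv/= => /andP[h1 h2]; apply/andP; split.
  by rewrite (le_trans ac)// lerD2l ler_pM2l.
by apply: le_trans cb; rewrite lerD2l ler_pM2l.
Qed.

Let inoo t : t \in `]- L, L[ -> c + e * t \in `]a, b[.
Proof.
rewrite !in_itv/= => /andP[h1 h2]; apply/andP; split.
  by rewrite (le_lt_trans ac)// ltrD2l ltr_pM2l.
by apply: lt_le_trans cb; rewrite ltrD2l ltr_pM2l.
Qed.

Lemma within_rescale (f : R -> R) : {within `[a, b], continuous f} ->
  {within `[- L, L], continuous (fun t => f (c + e * t))}.
Proof.
move=> /subspace_continuousP cf; apply/subspace_continuousP => t tL.
have H := cf (c + e * t) (inab tL).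
have ca : c + e * s @[s --> t] --> c + e * t.
  by apply: cvgD; [exact: cvg_cst|apply: cvgM; [exact: cvg_cst|exact: cvg_id]].
have ca' : c + e * s @[s --> within `[- L, L]%classic (nbhs t)] --> within `[a, b]%classic
  (nbhs (c + e * t)).
  move=> U HU; have := ca _ HU; rewrite /within /= !nbhs_simpl /=.
  by apply: filterS => s hs sL; apply: hs; exact: inab.
exact: (cvg_comp _ _ ca' H).
Qed.

Lemma is_derive_affine (t : R) : is_derive t 1 (fun s : R => c + e * s) e.
Proof.
by apply: (@is_derive_quadratic _ _ _ _ 0) => h; rewrite mul0r normr_le0; apply/eqP; ring.
Qed.

Lemma is_derive_rescale f (f' t : R) : is_derive (c + e * t) 1 f f' ->
  is_derive t 1 (fun s => f (c + e * s)) (e * f').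
Proof.
move=> h; have := @is_derive1_comp R f (fun s => c + e * s) t _ _ h (is_derive_affine t).
by move/is_derive_eq; apply; rewrite mulrC.
Qed.

Lemma C1c_unscale phi : C1c (- L) L phi ->
  C1c (c + e * - L) (c + e * L) (fun x => phi ((x - c) / e)) /\
  forall t, derive1 (fun x => phi ((x - c) / e)) (c + e * t) = e^-1 * derive1 phi t.
Proof.
move=> [dphi cphi' kphi sphi].
have da (x : R) : is_derive x 1 (fun x : R => (x - c) / e) e^-1.
  by apply: (@is_derive_quadratic _ _ _ _ 0) => h; rewrite mul0r normr_le0; apply/eqP; ring.
have d (x : R) : is_derive x 1 (fun x => phi ((x - c) / e)) (e^-1 * derive1 phi ((x - c) / e)).
  have dp : is_derive ((x - c) / e) 1 phi (derive1 phi ((x - c) / e)).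
    by rewrite derive1E; apply: derivableP; exact: dphi.
  have := @is_derive1_comp R phi (fun x => (x - c) / e) x _ _ dp (da x).
  by move/is_derive_eq; apply; rewrite mulrC.
have dE : derive1 (fun x => phi ((x - c) / e)) = (fun x => e^-1 * derive1 phi ((x - c) / e)).
  by apply/funext => x; rewrite derive1E; have [_] := d x.
have ca : continuous (fun x : R => (x - c) / e).
  by move=> x; apply/differentiable_continuous/derivable1_diffP; have [] := da x.
have sub : closure [set x | phi ((x - c) / e) != 0] `<=`
    (fun x => (x - c) / e) @^-1` (closure [set x | phi x != 0]).
  rewrite [X in _ `<=` X]((closure_id _).1 _); last first.
    by apply: closed_comp; [move=> x _; exact: ca|exact: closed_closure].
  by apply: closure_subset => x /= h; apply: subset_closure.
have sub2 : closure [set x | phi ((x - c) / e) != 0] `<=` `]c + e * - L, c + e * L[.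
  move=> x /sub /= /sphi /=; rewrite !in_itv/= => /andP[h1 h2].
  move: h1 h2; rewrite ltr_pdivlMr// ltr_pdivrMr// => h1 h2.
  apply/andP; split.
    by rewrite -ltrBrDl [e * _]mulrC.
  by rewrite -ltrBlDl [e * _]mulrC.
split.
  split.
  - by move=> x; have [] := d x.
  - rewrite dE => x; apply: cvgM; first exact: cvg_cst.
    by apply: (@continuous_comp _ _ _ (fun x : R => (x - c) / e) (derive1 phi));
      [exact: ca|exact: cphi'].
  - apply: (subclosed_compact _ (@segment_compact R (c + e * - L) (c + e * L)));
    first exact: closed_closure.
    by apply: subset_trans sub2 _; exact: subset_itv_oo_cc.
  - exact: sub2.
move=> t; rewrite dE; congr (_ * derive1 phi _).
by rewrite addrC addKr mulrC mulKf// gt_eqF.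
Qed.

Lemma C1cS x y phi : a <= x -> y <= b -> C1c x y phi -> C1c a b phi.
Proof.
move=> ax yb [? ? ? s]; split => //; apply: subset_trans s _.
by apply: subset_itv; rewrite bnd_simp.
Qed.

(** A test function for the blow-up, transported back by the affine map, is a test
    function on the original interval. *)
Lemma weak_rescale f h : Ioo_integrable a b f -> Ioo_integrable a b h ->
  weak_derivative a b f h ->
  weak_derivative (- L) L (fun t => f (c + e * t)) (fun t => e * h (c + e * t)).
Proof.
move=> iF ih wd phi cphi.
have [C D] := C1c_unscale cphi.
have Cab := C1cS ac cb C.
have [c1 c2] := C1c_within Cab.
pose psi x := phi ((x - c) / e); rewrite -/psi in C D Cab c1 c2.
have psiE t : psi (c + e * t) = phi t.
  by rewrite /psi addrC addKr mulrC mulKf// gt_eqF.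
have ale : c + e * - L <= c + e * L by rewrite lerD2l ler_pM2l// ge0_cp// ltW.
have zero f1 psi1 : (forall x, x \notin `]c + e * - L, c + e * L[ -> psi1 x = 0) ->
    Ioo_integrable a b (fun x => f1 x * psi1 x) ->
    Ioo_int a b (fun x => f1 x * psi1 x) =
      Ioo_int (c + e * - L) (c + e * L) (fun x => f1 x * psi1 x).
  move=> z i1.
  rewrite (Ioo_int_split ac (le_trans ale cb) i1).
  rewrite (Ioo_int_split ale cb (Ioo_integrableS ac (lexx b) i1)).
  rewrite (@eq_Ioo_int _ a _ _ (fun=> 0)); last first.
    move=> t; rewrite in_itv/= => /andP[_ h1]; rewrite z ?mulr0//.
    by rewrite in_itv/= ltNge (ltW h1).
  rewrite (@eq_Ioo_int _ _ b _ (fun=> 0)); last first.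
    move=> t; rewrite in_itv/= => /andP[h1 _]; rewrite z ?mulr0//.
    by rewrite in_itv/= [X in _ && X]ltNge (ltW h1) andbF.
  by rewrite !Ioo_int_cst// !mul0r add0r addr0.
have z1 x : x \notin `]c + e * - L, c + e * L[ -> psi x = 0.
  by move=> /(C1c_near0 C) /nbhs_singleton.
have z2 x : x \notin `]c + e * - L, c + e * L[ -> derive1 psi x = 0.
  move=> /(C1c_near0 C) h0; rewrite derive1E.
  have : is_derive x 1 psi 0.
    by apply: (@near_eq_is_derive _ _ _ (cst 0)); apply: filterS h0 => s ->.
  by case.
have i1 : Ioo_integrable a b (fun x => f x * derive1 psi x) by exact: Ioo_integrableM_continuous.
have i2 : Ioo_integrable a b (fun x => h x * psi x) by exact: Ioo_integrableM_continuous.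
have := wd _ Cab.
rewrite (zero _ _ z2 i1) (zero _ _ z1 i2).
rewrite (affine_Ioo_int e0 (Ioo_integrableS ac cb i1)) (affine_Ioo_int e0
  (Ioo_integrableS ac cb i2)).
rewrite (@eq_Ioo_int _ _ _ (fun t => f (c + e * t) * derive1 psi (c +
  e * t)) (fun t => e^-1 * (f (c + e * t) * derive1 phi t))); last first.
  by move=> t _; rewrite D; ring.
rewrite (@eq_Ioo_int _ _ _ (fun t => h (c + e * t) * psi (c + e * t)) (fun t => h (c +
  e * t) * phi t)); last first.
  by move=> t _; rewrite psiE.
have cphiw := C1c_within cphi.
rewrite Ioo_intZ; last first.
  by apply: Ioo_integrableM_continuous;
    [exact: cphiw.2|apply: (affine_Ioo_integrable e0 (Ioo_integrableS ac cb iF))].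
rewrite mulrA divff ?gt_eqF// mul1r => ->.
rewrite [in RHS](@eq_Ioo_int _ _ _ _ (fun t => e * (h (c + e * t) * phi t))); last
  by move=> t _; rewrite mulrA.
rewrite Ioo_intZ//.
by apply: Ioo_integrableM_continuous;
  [exact: cphiw.1|apply: (affine_Ioo_integrable e0 (Ioo_integrableS ac cb ih))].
Qed.

Lemma sq_rescale f (r : R) : square_integrable a b f ->
  square_integrable (- L) L (fun t => r * f (c + e * t)).
Proof.
move=> [mf sf]; have mf' : measurable_fun `]c + e * - L, c + e * L[ f.
  by apply: measurable_funS mf => //; apply: subset_itv; rewrite bnd_simp.
split.
  by apply: measurable_funM => //; exact: (affine_measurable_comp e0).
have := affine_Ioo_integrable e0 (Ioo_integrableS ac cb sf).
move=> /(Ioo_integrableZ (r ^+ 2)).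
have -> // : (fun t => r ^+ 2 * f (c + e * t) ^+ 2) = (fun t => (r * f (c + e * t)) ^+ 2).
by apply/funext => t; rewrite exprMn.
Qed.

Lemma weakZ x y f h r : Ioo_integrable x y f -> Ioo_integrable x y h -> weak_derivative x y f h ->
  weak_derivative x y (fun t => r * f t) (fun t => r * h t).
Proof.
move=> iF ih wd phi cphi; have [c1 c2] := C1c_within cphi.
have -> : Ioo_int x y (fun t => r * f t * derive1 phi t) =
  Ioo_int x y (fun t => r * (f t * derive1 phi t)).
  by apply: eq_Ioo_int => t _; rewrite mulrA.
have -> : Ioo_int x y (fun t => r * h t * phi t) = Ioo_int x y (fun t => r * (h t * phi t)).
  by apply: eq_Ioo_int => t _; rewrite mulrA.
rewrite !Ioo_intZ; [|exact: Ioo_integrableM_continuous|exact: Ioo_integrableM_continuous].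
by rewrite (wd _ cphi) mulrN.
Qed.

Definition rescale_W22 (u : W22 a b) : W22 (- L) L.
Proof.
apply: (@MkW22 R (- L) L (fun t => u (c + e * t)) (fun t => e * W22_d1 u (c + e * t))
  (fun t => e ^+ 2 * W22_d2 u (c + e * t))).
- have := @sq_rescale u 1 (W22_L2_fun u).
  have -> // : (fun t => 1 * u (c + e * t)) = (fun t => u (c + e * t)).
  by apply/funext => t; rewrite mul1r.
- exact: sq_rescale (W22_L2_d1 u).
- exact: sq_rescale (W22_L2_d2 u).
- apply: weak_rescale (W22_weak_d1 u);
  [exact: Ioo_integrable_continuous (@W22_continuous _ _ _ u)|
  exact: Ioo_integrable_continuous (@W22_d1_continuous _ _ _ u)].
- have h1 : Ioo_integrable a b (W22_d1 u)
  by exact: Ioo_integrable_continuous (@W22_d1_continuous _ _ _ u).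
  have := weakZ e (affine_Ioo_integrable e0 (Ioo_integrableS ac cb h1)) (Ioo_integrableZ e
    (affine_Ioo_integrable e0 (Ioo_integrableS ac cb (W22_d2_integrable u))))
     (weak_rescale h1 (W22_d2_integrable u) (W22_weak_d2 u)).
  have -> // : (fun t => e * (e * W22_d2 u (c + e * t))) =
    (fun t => e ^+ 2 * W22_d2 u (c + e * t)).
  by apply/funext => t; rewrite expr2 mulrA.
- split.
  + exact: within_rescale (@W22_continuous _ _ _ u).
  + apply: (within_continuousM (f := fun=> e)); first by move=> x; exact: cvg_cst.
    exact: within_rescale (@W22_d1_continuous _ _ _ u).
  + by move=> x xL; apply: is_derive_rescale; apply: W22_is_derive; exact: inoo.
Defined.

End Rescale.

(** * First and last critical points *)

Section Zeros.
Context {R : realType}.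

Lemma sign_no_zero (f : R -> R) (p q : R) : {within `[p, q], continuous f} ->
  (forall t, t \in `]p, q[ -> f t != 0) ->
  exists2 sg : R, pm_sign sg & forall t, t \in `]p, q[ -> 0 <= sg * f t.
Proof.
move=> cf nz; have [qp|pq] := leP q p.
  exists 1; first by left.
  move=> t; rewrite in_itv/= => /andP[h1 h2].
  by have := lt_trans h1 h2; rewrite ltNge qp.
have mI : (p + q) / 2 \in `]p, q[ by rewrite in_itv/=; apply/andP; split; lra.
have [m {}mI] : exists m, m \in `]p, q[ by exists ((p + q) / 2).
exists (if 0 <= f m then 1 else -1); first by case: ifP; [left|right].
move=> t tI; rewrite leNgt; apply/negP => H.
have opp s r : s \in `]p, q[ -> r \in `]p, q[ -> 0 <= f s -> f r < 0 -> False.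
  move=> sI rI fs fr.
  have cS x y : x \in `]p, q[ -> y \in `]p, q[ -> {within `[x, y], continuous f}.
    rewrite !in_itv/= => /andP[/ltW px _] /andP[_ /ltW yq].
    exact: within_continuousS px yq cf.
  have [sr|rs] := leP s r.
    have [||c cI fc] := @IVT R f s r 0 sr; first exact: cS.
      by rewrite ge_min (ltW fr) orbT/= le_max fs.
    suff cI' : c \in `]p, q[ by have := nz _ cI'; rewrite fc eqxx.
    move: sI rI cI; rewrite !in_itv/= => /andP[h1 _] /andP[_ h2] /andP[h3 h4].
    by rewrite (lt_le_trans h1)// (le_lt_trans h4).
  have [||c cI fc] := @IVT R f r s 0 (ltW rs); first exact: cS.
    by rewrite ge_min (ltW fr)/= le_max fs orbT.
  suff cI' : c \in `]p, q[ by have := nz _ cI'; rewrite fc eqxx.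
  move: sI rI cI; rewrite !in_itv/= => /andP[_ h1] /andP[h2 _] /andP[h3 h4].
  by rewrite (lt_le_trans h2)// (le_lt_trans h4).
case: ifPn H => [fm|]; first by rewrite mul1r; exact: opp fm.
by rewrite -ltNge mulN1r oppr_lt0 => fm /ltW ft; exact: opp ft fm.
Qed.

Lemma first_zero (f : R -> R) (a b z : R) : a <= b -> {within `[a, b], continuous f} ->
  z \in `[a, b] -> f z = 0 ->
  exists2 x, a <= x <= z & f x = 0 /\ forall t, t \in `]a, x[ -> f t != 0.
Proof.
move=> ab cf zI fz.
pose Z := [set t | t \in `[a, b] /\ f t = 0].
have Zz : Z z by [].
have lbZ : lbound Z a by move=> t [+ _]; rewrite in_itv/= => /andP[].
have hiZ : has_inf Z by split; [exists z|exists a].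
have az : a <= inf Z by apply: lb_le_inf => //; exists z.
have iz : inf Z <= z by apply: ge_inf => //; exists a.
exists (inf Z); first by rewrite az.
have zb : z <= b by move: zI; rewrite in_itv/= => /andP[].
have iI : inf Z \in `[a, b] by rewrite in_itv/= az (le_trans iz).
split; last first.
  move=> t; rewrite in_itv/= => /andP[at_ ti]; apply/eqP => ft.
  have Zt : Z t.
    by split => //; rewrite in_itv/= (ltW at_)/= (le_trans (ltW ti))// (le_trans iz).
  by have := ge_inf (ex_intro _ a lbZ) Zt; rewrite leNgt ti.
apply/eqP; apply: contrapT => /negP fi.
have /subspace_continuousP/(_ _ iI) := cf.
have fi0 : 0 < `|f (inf Z)| by rewrite normr_gt0.
move=> /cvgrPdist_lt/(_ _ fi0); rewrite /within /= => -[e /= e0 He].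
have [t Zt te] := inf_adherent e0 hiZ.
have [tI ft] := Zt.
have it : inf Z <= t by apply: ge_inf => //; exists a.
have te' : `|inf Z - t| < e by rewrite distrC ger0_norm ?subr_ge0// ltrBlDl.
by have := He _ te' tI; rewrite /from_subspace ft subr0 ltxx.
Qed.

Lemma last_zero (f : R -> R) (a b z : R) : a <= b -> {within `[a, b], continuous f} ->
  z \in `[a, b] -> f z = 0 ->
  exists2 x, z <= x <= b & f x = 0 /\ forall t, t \in `]x, b[ -> f t != 0.
Proof.
move=> ab cf zI fz.
have cf' : {within `[- b, - a], continuous (fun t => f (- t))}.
  have := @within_continuous_compN _ _ _ f (- b) (- a).
  by rewrite !opprK; exact.
have nba : - b <= - a by rewrite lerN2.
have zI' : - z \in `[- b, - a].
  by move: zI; rewrite !in_itv/= !lerN2 => /andP[-> ->].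
have fz' : f (- - z) = 0 by rewrite opprK.
have [x /andP[bx xz] [fx nz]] := first_zero nba cf' zI' fz'.
exists (- x); first by rewrite lerNr xz lerNl bx.
split=> // t; rewrite in_itv/= => /andP[xt tb].
by have := nz (- t); rewrite opprK; apply; rewrite in_itv/= ltrN2 tb ltrNl.
Qed.

End Zeros.

(** * The interpolation inequality for small parameters *)

Section Pieces.
Context {R : realType}.

(** Unless its derivative vanishes identically, V is a competitor for k_1. *)
Lemma neumann_bound (k L : R) (V : W22 (- L) L) : 0 < L -> (k%:E <= k1_const)%E ->
  W22_d1 V (- L) = 0 -> W22_d1 V L = 0 ->
  k * Ioo_int (- L) L (fun t => W22_d1 V t ^+ 2) <=
  Ioo_int (- L) L (fun t => double_well (V t)) + Ioo_int (- L) L (fun t => W22_d2 V t ^+ 2).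
Proof.
move=> L0 kk1 V1 V2.
have W0 : 0 <= Ioo_int (- L) L (fun t => double_well (V t))
  by apply: Ioo_int_ge0 => t _; exact: double_well_ge0.
have B0 : 0 <= Ioo_int (- L) L (fun t => W22_d2 V t ^+ 2)
  by apply: Ioo_int_ge0 => t _; exact: sqr_ge0.
have A0 : 0 <= Ioo_int (- L) L (fun t => W22_d1 V t ^+ 2)
  by apply: Ioo_int_ge0 => t _; exact: sqr_ge0.
move: A0; rewrite le_eqVlt => /predU1P[<-|A0]; first by rewrite mulr0 addr_ge0.
have nz : exists2 x, x \in `[- L, L] & W22_d1 V x != 0.
  apply: contrapT => /forall2NP H.
  move: A0; rewrite (@eq_Ioo_int _ _ _ _ (fun=> 0)); last first.
    move=> t tI; have [h|/negP] := H t.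
      by exfalso; apply: h; apply: subset_itv_oo_cc.
    by rewrite negbK => /eqP ->; rewrite expr0n.
  by rewrite Ioo_int_cst ?mul0r ?ltxx// ge0_cp// ltW.
have : (k%:E <= quotient_R V)%E.
  apply: (le_trans kk1); apply: (@le_trans _ _ (ereal_inf [set quotient_R u | u in
      [set u : W22 (- L) L | [/\ W22_d1 u (- L) = 0, W22_d1 u L = 0
                               & exists2 x, x \in `[- L, L] & W22_d1 u x != 0]]])).
    by apply: ereal_inf_lbound; exists L.
  by apply: ereal_inf_lbound; exists V.
rewrite /quotient_R A0 lee_fin ler_pdivlMr//.
by rewrite Ioo_intD//; [exact: W22_double_well_integrable|exact: W22_d2_sqr_integrable].
Qed.

Section OnPiece.
Variables (a b : R) (u : W22 a b) (e p q : R).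
Hypotheses (e0 : 0 < e) (ap : a <= p) (qb : q <= b).
Notation A := (Ioo_int p q (fun t => W22_d1 u t ^+ 2)).
Notation W := (Ioo_int p q (fun t => double_well (u t))).
Notation B := (Ioo_int p q (fun t => W22_d2 u t ^+ 2)).

(** The substitution x = c + e t turns the energy with parameter e into the energy with
    parameter 1. *)
Lemma rescaled_piece : p < q -> exists (L c : R) (V : W22 (- L) L),
  [/\ 0 < L, c + e * - L = p, c + e * L = q,
      forall t, W22_d1 V t = e * W22_d1 u (c + e * t) &
      [/\ Ioo_int (- L) L (fun t => double_well (V t)) = e^-1 * W,
          Ioo_int (- L) L (fun t => W22_d1 V t ^+ 2) = e * A &
          Ioo_int (- L) L (fun t => W22_d2 V t ^+ 2) = e ^+ 3 * B]].
Proof.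
move=> pq; pose L := (q - p) / (2 * e); pose c := (p + q) / 2.
have pE : c + e * - L = p by rewrite /c /L; field; exact: lt0r_neq0.
have qE : c + e * L = q by rewrite /c /L; field; exact: lt0r_neq0.
have L0 : 0 < L by rewrite divr_gt0 ?subr_gt0// mulr_gt0.
have ac : a <= c + e * - L by rewrite pE.
have cb : c + e * L <= b by rewrite qE.
have en : e != 0 by exact: lt0r_neq0.
have iW := Ioo_integrableS ac cb (W22_double_well_integrable u).
have iA := Ioo_integrableS ac cb (W22_d1_sqr_integrable u).
have iB := Ioo_integrableS ac cb (W22_d2_sqr_integrable u).
exists L, c, (rescale_W22 e0 L0 ac cb u); split => //; split => /=.
- by rewrite -{1}pE -{1}qE (affine_Ioo_int e0 iW) mulrA mulVf// mul1r.
- rewrite -{1}pE -{1}qE (affine_Ioo_int e0 iA) mulrA.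
  rewrite -Ioo_intZ; last exact: (affine_Ioo_integrable e0 iA).
  by apply: eq_Ioo_int => t _; rewrite exprMn expr2.
- rewrite -{1}pE -{1}qE (affine_Ioo_int e0 iB) mulrA.
  rewrite -Ioo_intZ; last exact: (affine_Ioo_integrable e0 iB).
  by apply: eq_Ioo_int => t _; rewrite exprMn; ring.
Qed.

Lemma monotone_piece (K C sg z : R) :
  monotone_estimate K C ->
  0 <= C -> pm_sign sg -> (forall t, t \in `]p, q[ -> 0 <= sg * W22_d1 u t) ->
  p <= z -> z <= q -> W22_d1 u z = 0 ->
  K * (e * A) <= e^-1 * W + e ^+ 3 * B + C.
Proof.
move=> HK C0 sgE sw pz zq wz.
have [qp|pq] := leP q p; first by rewrite !Ioo_int_empty// !mulr0 !add0r.
have [L [c [V [L0 pE qE V1 [<- <- <-]]]]] := rescaled_piece pq.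
have LL : - L < L by rewrite gt0_cp.
apply: (HK _ _ V sg ((z - c) / e)) => //.
- move=> t; rewrite in_itv/= V1 => /andP[h1 h2].
  rewrite mulrCA mulr_ge0 ?(ltW e0)//; apply: sw.
  by rewrite in_itv/= -pE -qE !ltrD2l !ltr_pM2l// h1.
- rewrite in_itv/= ler_pdivlMr// ler_pdivrMr//; apply/andP; split.
    by rewrite lerBrDl mulrC pE.
  by rewrite lerBlDl mulrC qE.
- rewrite V1 (_ : c + _ = z) ?wz ?mulr0//; field; exact: lt0r_neq0.
Qed.

Lemma neumann_piece (k : R) : (k%:E <= k1_const)%E -> W22_d1 u p = 0 -> W22_d1 u q = 0 ->
  k * (e * A) <= e^-1 * W + e ^+ 3 * B.
Proof.
move=> kk1 wp wq.
have [qp|pq] := leP q p; first by rewrite !Ioo_int_empty// !mulr0 !add0r.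
have [L [c [V [L0 pE qE V1 [<- <- <-]]]]] := rescaled_piece pq.
by apply: neumann_bound => //; rewrite V1 ?pE ?qE ?wp ?wq mulr0.
Qed.
End OnPiece.

(** Cut the interval at the first and the last zero of the derivative: u is monotone
    on the outer pieces, and the middle piece satisfies the Neumann condition of
    the definition of k_1. *)
Lemma interpolation_bound (k : R) : 0 < k -> (k%:E <= k1_const)%E ->
  exists2 C : R, 0 <= C & forall (a b e z : R) (u : W22 a b), a < b -> 0 < e ->
    z \in `]a, b[ -> W22_d1 u z = 0 ->
    k * (e * Ioo_int a b (fun t => W22_d1 u t ^+ 2)) <=
    e^-1 * Ioo_int a b (fun t => double_well (u t)) +
      e ^+ 3 * Ioo_int a b (fun t => W22_d2 u t ^+ 2) + C.
Proof.
move=> k0 kk1; have [C C0 HC] := monotone_bound k0.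
exists (C + C); first by rewrite addr_ge0.
move=> a b e z u ab e0 zI wz.
have zI' : z \in `[a, b] by apply: subset_itv_oo_cc.
have [x1 /andP[ax1 x1z] [wx1 nz1]] := first_zero (ltW ab) (@W22_d1_continuous _ _ _ u) zI' wz.
have [x2 /andP[zx2 x2b] [wx2 nz2]] := last_zero (ltW ab) (@W22_d1_continuous _ _ _ u) zI' wz.
have x12 : x1 <= x2 by rewrite (le_trans x1z).
have x1b : x1 <= b by rewrite (le_trans x12).
have ax2 : a <= x2 by rewrite (le_trans ax1).
have [sg1 sg1E sw1] := sign_no_zero (within_continuousS (lexx a) x1b
  (@W22_d1_continuous _ _ _ u)) nz1.
have [sg2 sg2E sw2] := sign_no_zero (within_continuousS ax2 (lexx b)
  (@W22_d1_continuous _ _ _ u)) nz2.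
have P1 := @monotone_piece a b u e a x1 e0 (lexx a) x1b k C sg1 x1 HC C0 sg1E sw1 ax1
  (lexx x1) wx1.
have P2 := @neumann_piece a b u e x1 x2 e0 ax1 x2b k kk1 wx1 wx2.
have P3 := @monotone_piece a b u e x2 b e0 ax2 (lexx b) k C sg2 x2 HC C0 sg2E sw2
  (lexx x2) x2b wx2.
have S f : Ioo_integrable a b f ->
  Ioo_int a b f = Ioo_int a x1 f + (Ioo_int x1 x2 f + Ioo_int x2 b f).
  move=> iF; rewrite (Ioo_int_split ax1 x1b iF).
  by rewrite (Ioo_int_split x12 x2b (Ioo_integrableS ax1 (lexx b) iF)).
rewrite (S _ (W22_double_well_integrable u)) (S _ (W22_d1_sqr_integrable u)) (S _
  (W22_d2_sqr_integrable u)).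
apply: (le_trans (_ : _ <= _ + (_ + _))).
  by rewrite !mulrDr; apply: lerD P1 (lerD P2 P3).
rewrite le_eqVlt; apply/orP; left; apply/eqP; ring.
Qed.
End Pieces.

(** * Compactness along an ultrafilter *)

Section UltraCompactness.
Context {R : realType}.

(** A bounded sequence has a cluster point by compactness, and an ultrafilter
    converges to its cluster points. *)
Lemma ultra_bounded_cvg (U : set_system nat) (f : nat -> R) (M : R) : UltraFilter U ->
  (\forall n \near U, `|f n| <= M) -> exists l : R, f n @[n --> U] --> l.
Proof.
move=> FU fM.
have PF : ProperFilter (f n @[n --> U]) by apply: fmap_proper_filter; exact: ultra_proper.
have UM : (f n @[n --> U]) `[- M, M]%classic.
  by apply: filterS fM => n; rewrite /= in_itv/= ler_norml.
have [l [_ cl]] := @segment_compact R (- M) M _ PF UM.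
exists l => A Al; have [//|UA] := in_ultra_setVsetC (f @^-1` A) FU.
have [x [/= nAx Ax]] := cl (~` A) A UA Al.
by [].
Qed.

Variables (a b B C : R).
Hypothesis ab : a < b.
Variables (U : set_system nat) (zs Vs : nat -> R -> R).
Hypotheses (FU : UltraFilter U)
  (zB : \forall n \near U, forall x, x \in `[a, b] -> `|zs n x| <= B)
  (VC : \forall n \near U, forall x, x \in `[a, b] -> 0 <= Vs n x <= C)
  (zV : \forall n \near U, forall x y, x \in `[a, b] -> y \in `[a, b] -> x <= y ->
     `|zs n y - zs n x| <= Vs n y - Vs n x)
  (mz : forall n, measurable_fun `]a, b[ (zs n)).

(** A form of the theorem of Helly. Pointwise limits along the ultrafilter exist
    without any diagonal argument. They give convergence in L^1 because increments
    of z_n are dominated by those of V_n: on a grid of mesh h, the increments over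
    the cells add up to at most 2 C, so the error between grid points contributes
    at most 2 C h to the integral. *)
Lemma bv_ultra_limit : exists z : R -> R,
  [/\ measurable_fun `]a, b[ z, forall x, x \in `[a, b] -> `|z x| <= B &
      Ioo_int a b (fun x => `|zs n x - z x|) @[n --> U] --> (0 : R)].
Proof.
have PU : ProperFilter U by exact: ultra_proper.
have [z zE] : exists z : R -> R, forall x, x \in `[a, b] -> zs n x @[n --> U] --> z x.
  suff /choice[z zE] : forall x, exists l : R, x \in `[a, b] -> zs n x @[n --> U] --> l
    by exists z.
  move=> x.
  have [xI|] := boolP (x \in `[a, b]); last by exists 0.
  have [l] := @ultra_bounded_cvg U (fun n => zs n x) B FU (filterS (fun n h => h x xI) zB).
  by exists l.
have [V VE] : exists V : R -> R, forall x, x \in `[a, b] -> Vs n x @[n --> U] --> V x.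
  suff /choice[V VE] : forall x, exists l : R, x \in `[a, b] -> Vs n x @[n --> U] --> l
    by exists V.
  move=> x.
  have [xI|] := boolP (x \in `[a, b]); last by exists 0.
  have [|l] := @ultra_bounded_cvg U (fun n => Vs n x) C FU.
    by apply: filterS VC => n /(_ _ xI) /andP[h1 h2]; rewrite ger0_norm.
  by exists l.
have zV' x y : x \in `[a, b] -> y \in `[a, b] -> x <= y -> `|z y - z x| <= V y - V x.
  move=> xI yI xy.
  have c : Vs n y - Vs n x - `|zs n y - zs n x| @[n --> U] --> V y - V x - `|z y - z x|.
    apply: cvgB; first by apply: cvgB; exact: VE.
    by apply: cvg_norm; apply: cvgB; exact: zE.
  rewrite -subr_ge0; apply: (cvgr_to_ge c).
  by apply: filterS zV => n /(_ _ _ xI yI xy); rewrite subr_ge0.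
have VC' x : x \in `[a, b] -> 0 <= V x <= C.
  move=> xI; apply/andP; split.
    by apply: (cvgr_to_ge (VE _ xI)); apply: filterS VC => n /(_ _ xI) /andP[].
  by apply: (cvgr_to_le (VE _ xI)); apply: filterS VC => n /(_ _ xI) /andP[].
have zB' x : x \in `[a, b] -> `|z x| <= B.
  move=> xI; have c : `|zs n x| @[n --> U] --> `|z x| by apply: cvg_norm; exact: zE.
  by apply: (cvgr_to_le c); apply: filterS zB => n /(_ _ xI).
(* z is the difference of the nondecreasing functions z + V and V; the clamp cl
   makes them monotone on the whole line *)
have mzz : measurable_fun `]a, b[ z.
  pose cl x : R := Num.min (Num.max x a) b.
  have clI x : cl x \in `[a, b].
    by rewrite in_itv/= /cl le_min ge_min le_max !lexx (ltW ab) !orbT.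
  have clE x : x \in `]a, b[ -> cl x = x.
    rewrite in_itv/= => /andP[/ltW ax /ltW xb]; rewrite /cl.
    by rewrite (max_idPl ax) (min_idPl xb).
  have clm x y : x <= y -> cl x <= cl y.
    by move=> xy; apply: le_min2 => //; exact: le_max2.
  have m1 : measurable_fun `]a, b[ (fun x => V (cl x)).
    apply: nondecreasing_measurable => // x y xy.
    by have := zV' _ _ (clI x) (clI y) (clm _ _ xy); move/(le_trans (normr_ge0 _));
      rewrite subr_ge0.
  have m2 : measurable_fun `]a, b[ (fun x => z (cl x) + V (cl x)).
    apply: nondecreasing_measurable => // x y xy.
    by have := zV' _ _ (clI x) (clI y) (clm _ _ xy); rewrite ler_norml => /andP[h _]; lra.
  apply: eq_measurable_fun (measurable_funB m2 m1) => x.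
  by rewrite inE/= => xI; rewrite clE// addrK.
exists z; split => //.
have iz : \forall n \near U, forall x y, a <= x -> y <= b ->
  Ioo_integrable x y (fun x => `|zs n x - z x|).
  apply: filterS zB => n H x y ax yb; apply: Ioo_integrable_norm.
  apply: Ioo_integrableS ax yb _; apply: (Ioo_integrable_dominated (g := fun=> B + B));
    last 1 first.
  - move=> t tI; have tI' : t \in `[a, b] by apply: subset_itv_oo_cc.
    by rewrite (le_trans (ler_normB _ _))// lerD ?H ?zB'.
  - exact: measurable_funB.
  - exact: Ioo_integrable_cst.
(* On a cell of the grid, z_n - z differs from its value at the left end by at
   most the increments of V_n and of V over the cell. *)
have grid (h d : R) (N : nat) : 0 < h -> 0 < d -> a + h * N%:R <= b ->
   \forall n \near U, Ioo_int a (a + h * N%:R) (fun x => `|zs n x - z x|) <=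
     h * (Vs n (a + h * N%:R) + V (a + h * N%:R)) + d * (h * N%:R).
  move=> h0 d0; elim: N => [|N IH] hN.
    have -> : a + h * 0%:R = a by rewrite mulr0n mulr0 addr0.
    have -> : d * (h * 0%:R) = 0 by rewrite mulr0n !mulr0.
    have aI : a \in `[a, b] by rewrite in_itv/= lexx ltW.
    apply: filterS VC => n /(_ _ aI) /andP[V0 _].
    by rewrite addr0 Ioo_int_empty// mulr_ge0 ?(ltW h0)// addr_ge0//; have /andP[] := VC' _ aI.
  have hS : a + h * N.+1%:R = a + h * N%:R + h by rewrite -natr1; ring.
  rewrite hS in hN *.
  have hN' : a + h * N%:R <= b by rewrite (le_trans _ hN)// lerDl ltW.
  have aN : a <= a + h * N%:R by rewrite lerDl mulr_ge0 ?ler0n ?ltW.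
  have [t tE] : exists t, t = a + h * N%:R by eexists.
  rewrite -tE in hN hN' aN IH *.
  have tI : t \in `[a, b] by rewrite in_itv/= aN.
  have tI' : t + h \in `[a, b] by rewrite in_itv/= hN (le_trans aN)// lerDl ltW.
  have := zE _ tI => /cvgrPdist_le/(_ _ d0) close.
  near=> n.
  have iz' : forall x y, a <= x -> y <= b -> Ioo_integrable x y (fun x => `|zs n x - z x|).
    by near: n.
  have tth : t <= t + h by rewrite lerDl ltW.
  rewrite (Ioo_int_split aN tth (iz' _ _ (lexx a) hN)).
  have IHn : Ioo_int a t (fun x => `|zs n x - z x|) <= h * (Vs n t + V t) + d * (h * N%:R).
    by near: n; exact: IH.
  have step : Ioo_int t (t + h) (fun x => `|zs n x - z x|) <=
      Ioo_int t (t + h) (fun=> (Vs n (t + h) - Vs n t) + d + (V (t + h) - V t)).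
    apply: Ioo_int_le; [exact: iz'|exact: Ioo_integrable_cst|] => x;
      rewrite in_itv/= => /andP[tx xt].
    have xI : x \in `[a, b].
      by rewrite in_itv/= (le_trans aN (ltW tx)) (le_trans (ltW xt)).
    have zVn : forall x y, x \in `[a, b] -> y \in `[a, b] -> x <= y ->
       `|zs n y - zs n x| <= Vs n y - Vs n x by near: n.
    have k1 := zVn _ _ tI xI (ltW tx).
    have k2 := zVn _ _ xI tI' (ltW xt).
    have k3 := zV' _ _ tI xI (ltW tx).
    have k4 := zV' _ _ xI tI' (ltW xt).
    have k5 : `|z t - zs n t| <= d by near: n.
    have -> : zs n x - z x = (zs n x - zs n t) - (z t - zs n t) - (z x - z t) by ring.
    rewrite (le_trans (ler_normB _ _))//.
    have := ler_normB (zs n x - zs n t) (z t - zs n t).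
    have := normr_ge0 (zs n (t + h) - zs n x); have := normr_ge0 (z (t + h) - z x).
    lra.
  rewrite (Ioo_int_cst _ tth) in step.
  have th : t + h - t = h by ring.
  rewrite th in step; rewrite -natr1; lra.
apply/cvgrPdist_le => e e0.
have C0 : 0 <= C.
  have aI : a \in `[a, b] by rewrite in_itv/= lexx ltW.
  by have /andP[h1 h2] := VC' _ aI; exact: le_trans h2.
have ba : 0 < b - a by rewrite subr_gt0.
have [N HN] : exists N : nat, 4 * C * (b - a) / e <= N%:R.
  exists (Num.bound (4 * C * (b - a) / e)); apply/ltW/archi_boundP.
  apply: divr_ge0; last exact: ltW.
  by apply: mulr_ge0; [exact: mulr_ge0|exact: ltW].
have N0 : 0 < N.+1%:R :> R by rewrite ltr0n.
have h0 : 0 < (b - a) / N.+1%:R by rewrite divr_gt0.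
have d0 : 0 < e / (2 * (b - a)) by rewrite divr_gt0// mulr_gt0.
have endE : a + (b - a) / N.+1%:R * N.+1%:R = b by rewrite divfK ?lt0r_neq0// addrC subrK.
have := grid _ _ N.+1 h0 d0; rewrite endE => /(_ (lexx b)) G.
have bI : b \in `[a, b] by rewrite in_itv/= lexx ltW.
near=> n.
rewrite sub0r normrN ger0_norm; last by apply: Ioo_int_ge0 => t _.
have /le_trans -> // : Ioo_int a b (fun x => `|zs n x - z x|) <=
  (b - a) / N.+1%:R * (Vs n b + V b) + e / (2 * (b - a)) * ((b - a) / N.+1%:R * N.+1%:R).
  by near: n.
have -> : e / (2 * (b - a)) * ((b - a) / N.+1%:R * N.+1%:R) = e / 2.
  by field; rewrite !lt0r_neq0.
have Vn : 0 <= Vs n b <= C by near: n; apply: filterS VC => n; exact.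
have /andP[_ Vb] := VC' _ bI; move/andP: Vn => [_ Vn].
have : (b - a) / N.+1%:R * (Vs n b + V b) <= (b - a) / N.+1%:R * (2 * C).
  by rewrite ler_wpM2l ?(ltW h0)//; lra.
have : (b - a) / N.+1%:R * (2 * C) <= e / 2.
  rewrite mulrAC ler_pdivrMr//.
  have : 4 * C * (b - a) / e <= N.+1%:R by rewrite (le_trans HN)// ler_nat.
  by rewrite ler_pdivrMr//; lra.
move: ((b - a) / N.+1%:R * (Vs n b + V b)) ((b - a) / N.+1%:R * (2 * C)) => X Y h1 h2.
by rewrite [leRHS](splitr e) lerD2r (le_trans h2 h1).
Unshelve. all: by end_near. Qed.

End UltraCompactness.

(** * The Modica-Mortola profile *)

Section Profile.
Context {R : realType}.

(** The primitive of 3 (1 - s^2) / 2 that vanishes at 0, normalised so that it fixes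
    the two wells. *)
Definition mm_profile (s : R) : R := (3 * s - s ^+ 3) / 2.
Definition mm_profile' (s : R) : R := 3 * (1 - s ^+ 2) / 2.

Lemma is_derive_mm_profile (s : R) : is_derive s 1 mm_profile (mm_profile' s).
Proof.
have -> : mm_profile = 2^-1 *: ((3 : R) *: (id : R -> R) - (id : R -> R) ^+ 3).
  by apply/funext => t; rewrite /mm_profile mulrC.
by apply: is_derive_eq; rewrite /mm_profile' /GRing.scale/=; field.
Qed.

Lemma continuous_mm_profile' : continuous mm_profile'.
Proof.
move=> s; apply: cvgM; last exact: cvg_cst.
apply: cvgM; first exact: cvg_cst.
by apply: cvgB; [exact: cvg_cst|exact: exprn_continuous].
Qed.

Lemma continuous_mm_profile : continuous mm_profile.
Proof. by move=> s; apply/differentiable_continuous/derivable1_diffP;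
  have [] := is_derive_mm_profile s. Qed.

(** The inequality of Modica and Mortola: |1 - s^2| |p| is twice the square root of
    W(s) times |p|, to which Young's inequality with weight e is applied. *)
Lemma mm_profile'_mul_le (e s p : R) : 0 < e ->
  `|mm_profile' s * p| <= 3 / 2 * (e^-1 * double_well s + e * p ^+ 2).
Proof.
move=> e0; rewrite /mm_profile' /double_well.
have -> : 3 * (1 - s ^+ 2) / 2 * p = 3 / 2 * ((1 - s ^+ 2) * p) by ring.
rewrite normrM ger0_norm// ler_pM2l// normrM.
have -> : (s ^+ 2 - 1) ^+ 2 = `|1 - s ^+ 2| ^+ 2 by rewrite real_normK ?num_real// -sqrrN opprB.
rewrite -[p ^+ 2](real_normK (num_real p)).
move: `|1 - s ^+ 2| `|p| => x y.
have -> : e^-1 * (x ^+ 2 / 4) + e * y ^+ 2 = x * y + (x / 2 - e * y) ^+ 2 / e.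
  by field; exact: lt0r_neq0.
by rewrite lerDl divr_ge0 ?sqr_ge0// ltW.
Qed.

Lemma mm_profile_sqr (s : R) : mm_profile s ^+ 2 - 1 = double_well s * (s ^+ 2 - 4).
Proof. by rewrite /mm_profile /double_well; field. Qed.

Lemma mm_profile_coercive (s : R) : s ^+ 2 <= mm_profile s ^+ 2 + 5.
Proof.
have -> : mm_profile s ^+ 2 = s ^+ 2 * (s ^+ 2 - 3) ^+ 2 / 4 by rewrite /mm_profile; field.
have := sqr_ge0 s; move: (s ^+ 2) => q q0.
have [q5|q5] := leP q 5.
  by rewrite (le_trans q5)// lerDr divr_ge0// mulr_ge0// sqr_ge0.
have h : 4 <= (q - 3) ^+ 2 by nra.
have : q * 4 <= q * (q - 3) ^+ 2 by rewrite ler_wpM2l.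
lra.
Qed.

Lemma mm_profile_le (s q : R) : s ^+ 2 <= q -> `|mm_profile s| <= (1 + q) * (3 + q).
Proof.
move=> sq.
have s1 : `|s| <= 1 + q.
  apply: le_trans (_ : 1 + s ^+ 2 <= _); last by rewrite lerD2l.
  by rewrite -(real_normK (num_real s)); have := normr_ge0 s; nra.
have s0 := sqr_ge0 s.
have s2 : `|3 - s ^+ 2| <= 3 + q by rewrite ler_norml; apply/andP; split; lra.
have -> : mm_profile s = s * (3 - s ^+ 2) / 2 by rewrite /mm_profile; ring.
rewrite normrM normfV [`|2|]ger0_norm// ler_pdivrMr// normrM.
have h : `|s| * `|3 - s ^+ 2| <= (1 + q) * (3 + q) by exact: ler_pM.
have : 0 <= (1 + q) * (3 + q) by rewrite mulr_ge0//; lra.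
lra.
Qed.

(** s - mm_profile s = s (s^2 - 1) / 2, and |s^2 - 1| is at most t + (s^2 - 1)^2 / t. *)
Lemma sub_mm_profile_le (s M t : R) : `|s| <= M -> 0 < t ->
  `|s - mm_profile s| <= M / 2 * (t + 4 / t * double_well s).
Proof.
move=> sM t0.
have -> : s - mm_profile s = s * (s ^+ 2 - 1) / 2 by rewrite /mm_profile; field.
rewrite -mulrA normrM [leRHS]mulrAC -[leRHS]mulrA.
apply: ler_pM => //.
rewrite normrM normfV [`|2|]ger0_norm// ler_pM2r ?invr_gt0//.
rewrite /double_well -[(s ^+ 2 - 1) ^+ 2](real_normK (num_real _)).
move: `|s ^+ 2 - 1| (normr_ge0 (s ^+ 2 - 1)) => x x0.
have -> : t + 4 / t * (x ^+ 2 / 4) = x + ((x - t / 2) ^+ 2 + 3 / 4 * t ^+ 2) / t.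
  by field; exact: lt0r_neq0.
by rewrite lerDl divr_ge0 ?(ltW t0)// addr_ge0 ?sqr_ge0// mulr_ge0 ?sqr_ge0.
Qed.

End Profile.

Section Estimates.
Context {R : realType}.
Variables (a b : R) (u : W22 a b).
Hypothesis ab : a < b.
Variables (e C : R).
Hypotheses (e0 : 0 < e).
Notation w := (W22_d1 u).
Notation g := (W22_d2 u).
Notation A := (Ioo_int a b (fun t => w t ^+ 2)).
Notation B := (Ioo_int a b (fun t => g t ^+ 2)).
Notation Wt := (Ioo_int a b (fun t => double_well (u t))).

Lemma energyE (k : R) : energy k e u = e^-1 * Wt - k * (e * A) + e ^+ 3 * B.
Proof.
rewrite /energy.
have iW := W22_double_well_integrable u; have iA := W22_d1_sqr_integrable u;
  have iB := W22_d2_sqr_integrable u.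
have -> : Ioo_int a b (fun x => double_well (u x) / e - k * e * w x ^+ 2 + e ^+ 3 * g x ^+ 2) =
  Ioo_int a b (fun x => (e^-1 * double_well (u x) - k * e * w x ^+ 2) + e ^+ 3 * g x ^+ 2).
  by apply: eq_Ioo_int => x _; rewrite mulrC.
rewrite Ioo_intD; [|apply: Ioo_integrableB; exact: Ioo_integrableZ|exact: Ioo_integrableZ].
rewrite Ioo_intB; [|exact: Ioo_integrableZ|exact: Ioo_integrableZ].
by rewrite !Ioo_intZ// mulrA.
Qed.

(** A density that dominates the derivative of mm_profile (u x); its primitive
    mm_measure plays the role of the monotone functions V_n in bv_ultra_limit. *)
Definition mm_density x := 3 / 2 * (e^-1 * double_well (u x) + e * w x ^+ 2).
Definition mm_measure x := Ioo_int a x mm_density.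

Lemma mm_density_ge0 x : 0 <= mm_density x.
Proof.
apply: mulr_ge0 => //; apply: addr_ge0; apply: mulr_ge0;
  rewrite ?sqr_ge0 ?double_well_ge0 ?invr_ge0//.
all: exact: ltW.
Qed.

Lemma mm_density_integrable : Ioo_integrable a b mm_density.
Proof.
by apply: Ioo_integrableZ; apply: Ioo_integrableD; apply: Ioo_integrableZ;
  [exact: W22_double_well_integrable|exact: W22_d1_sqr_integrable].
Qed.

Lemma mm_measureE x y : a <= x -> x <= y -> y <= b ->
  mm_measure y - mm_measure x = Ioo_int x y mm_density.
Proof.
move=> ax xy yb; rewrite /mm_measure (Ioo_int_split ax xy (Ioo_integrableS
  (lexx a) yb mm_density_integrable)).
by rewrite addrC addKr.
Qed.

Hypotheses (WC : e^-1 * Wt <= C) (AC : e * A <= C).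

Lemma mm_measure_bound x : x \in `[a, b] -> 0 <= mm_measure x <= 3 * C.
Proof.
rewrite in_itv/= => /andP[ax xb]; apply/andP; split.
  by apply: Ioo_int_ge0 => t _; exact: mm_density_ge0.
apply: (@le_trans _ _ (Ioo_int a b mm_density)).
  by apply: (Ioo_int_subitv (lexx a) ax xb mm_density_integrable) => t _; exact: mm_density_ge0.
rewrite Ioo_intZ; last by apply: Ioo_integrableD; apply: Ioo_integrableZ;
  [exact: W22_double_well_integrable|exact: W22_d1_sqr_integrable].
rewrite Ioo_intD; [|apply: Ioo_integrableZ;
  exact: W22_double_well_integrable|apply: Ioo_integrableZ; exact: W22_d1_sqr_integrable].
rewrite !Ioo_intZ; [|exact: W22_double_well_integrable|exact: W22_d1_sqr_integrable].
have -> : 3 * C = 3 / 2 * (C + C) by field.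
by rewrite ler_pM2l// lerD.
Qed.

Lemma mm_profile_C1 : C1_closed a b (fun t => mm_profile (u t)) (fun t => mm_profile'
  (u t) * w t).
Proof. by apply: C1_closed_comp; [exact: is_derive_mm_profile|exact: continuous_mm_profile']. Qed.

Lemma mm_profile_variation x y : x \in `[a, b] -> y \in `[a, b] -> x <= y ->
  `|mm_profile (u y) - mm_profile (u x)| <= mm_measure y - mm_measure x.
Proof.
rewrite !in_itv/= => /andP[ax xb] /andP[ay yb] xy.
have [c1 c2 d] := mm_profile_C1.
have dd t : t \in `]x, y[ -> is_derive t 1 (fun t => mm_profile (u t)) (mm_profile' (u t) * w t).
  rewrite in_itv/= => /andP[xt ty]; apply: d.
  by rewrite in_itv/= (le_lt_trans ax xt) (lt_le_trans ty yb).
have X := Ioo_int_FTC2 xy (within_continuousS ax yb c2) (within_continuousS ax yb c1) dd.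
cbv beta in X; rewrite -X {X}.
rewrite mm_measureE//.
have i2 := Ioo_integrableS ax yb (Ioo_integrable_continuous c2).
apply: (le_trans (Ioo_int_norm i2)); apply: Ioo_int_le;
  [exact: Ioo_integrable_norm|exact: Ioo_integrableS ax yb mm_density_integrable|].
by move=> t _; exact: mm_profile'_mul_le.
Qed.

Lemma mm_profile_weak_le phi : C1c a b phi -> (forall x, `|phi x| <= 1) ->
  Ioo_int a b (fun x => mm_profile (u x) * derive1 phi x) <= 3 * C.
Proof.
move=> cphi phi1; have [c1 c2 d] := mm_profile_C1; have [p1 p2] := C1c_within cphi.
have [dphi _ _ _] := cphi.
have pa : phi a = 0 by apply: nbhs_singleton (C1c_near0 cphi _); rewrite in_itv/= ltxx.
have pb : phi b = 0 by apply: nbhs_singleton (C1c_near0 cphi _); rewrite in_itv/= ltxx andbF.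
have i1 : Ioo_integrable a b (fun x => mm_profile (u x) * derive1 phi x)
  by exact: Ioo_integrable_continuous (within_continuousM c1 p2).
have i2 : Ioo_integrable a b (fun x => mm_profile' (u x) * w x * phi x)
  by exact: Ioo_integrable_continuous (within_continuousM c2 p1).
have cs : {within `[a, b], continuous (fun x => mm_profile (u x) * derive1 phi x +
  mm_profile' (u x) * w x * phi x)}.
  exact: within_continuousD_fun (within_continuousM c1 p2) (within_continuousM c2 p1).
have cz : {within `[a, b], continuous (fun x => mm_profile (u x) * phi x)}
  by exact: within_continuousM.
have dd x : x \in `]a, b[ -> is_derive x 1 (fun x => mm_profile (u x) * phi x)
    (mm_profile (u x) * derive1 phi x + mm_profile' (u x) * w x * phi x).
  move=> xI; have h1 := d _ xI.
  have h2 : is_derive x 1 phi (derive1 phi x) by rewrite derive1E; apply: derivableP; exact: dphi.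
  have := is_deriveM h1 h2; move/is_derive_eq; apply.
  by rewrite /GRing.scale/= [phi x * _]mulrC.
have X := Ioo_int_FTC2 (ltW ab) cs cz dd.
have : Ioo_int a b (fun x => mm_profile (u x) * derive1 phi x +
  mm_profile' (u x) * w x * phi x) = 0.
  by rewrite X pa pb !mulr0 subrr.
rewrite Ioo_intD// => E.
have bI : b \in `[a, b] by rewrite in_itv/= lexx ltW.
have /andP[_ mC] := mm_measure_bound bI.
have : - Ioo_int a b (fun x => mm_profile' (u x) * w x * phi x) <= mm_measure b.
  apply: (le_trans (ler_norm _)); rewrite normrN; apply: (le_trans (Ioo_int_norm i2)).
  apply: Ioo_int_le; [exact: Ioo_integrable_norm|exact: mm_density_integrable|] => t _.
  rewrite normrM (le_trans _ (@mm_profile'_mul_le _ e (u t) (w t) e0))//.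
  by rewrite -[leRHS]mulr1 ler_wpM2l.
lra.
Qed.

Hypothesis e1 : e <= 1.

(** At some point W(u) is close to its mean or below it, which bounds u and its profile
    there; elsewhere the profile differs by at most its variation. *)
Lemma mm_profile_bounded x : x \in `[a, b] ->
  `|mm_profile (u x)| <= (1 + ((C + 1) / (b - a) + 2)) * (3 + ((C + 1) / (b - a) + 2)) + 3 * C.
Proof.
move=> xI.
have [t tI Ht] := exists_le_average ab (@ltr01 R) (W22_double_well_integrable u).
have C0 : 0 <= C.
  have := mm_measure_bound xI => /andP[h1 h2]; have := le_trans h1 h2; lra.
have ba : 0 < b - a by rewrite subr_gt0.
have WtC : Wt <= C.
  have : Wt <= C * e by rewrite mulrC -ler_pdivrMl.
  by move/le_trans; apply; rewrite -[leRHS]mulr1 ler_wpM2l.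
have ut : u t ^+ 2 <= (C + 1) / (b - a) + 2.
  have := @double_well_coercive R 1 (u t) ltr01; rewrite mul1r invr1 => h.
  rewrite (le_trans h)// lerD ?lerD2r// ler_pdivlMr// (le_trans Ht)// lerD2r//.
have zt := mm_profile_le ut.
have tI' : t \in `[a, b] by apply: subset_itv_oo_cc.
have d : `|mm_profile (u x) - mm_profile (u t)| <= 3 * C.
  have [xt|/ltW tx] := leP x t.
    rewrite distrC (le_trans (mm_profile_variation xI tI' xt))//.
    have /andP[_ h1] := mm_measure_bound tI'; have /andP[h2 _] := mm_measure_bound xI; lra.
  rewrite (le_trans (mm_profile_variation tI' xI tx))//.
  have /andP[_ h1] := mm_measure_bound xI; have /andP[h2 _] := mm_measure_bound tI'; lra.
rewrite -[mm_profile (u x)](subrK (mm_profile (u t))) addrC (le_trans (ler_normD _ _))// lerD//.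
Qed.

End Estimates.

(** With X = e^-1 int W(u) + e^3 int (u'')^2, the energy is at least
    X - (k / k') (X + C), and k / k' < 1. *)
Lemma energy_coercive {R : realType} (k k' C M : R) : 0 < k -> k < k' -> 0 <= C ->
  exists C2 : R, forall (a b e : R) (u : W22 a b), 0 < e -> energy k e u <= M ->
  k' * (e * Ioo_int a b (fun t => W22_d1 u t ^+ 2)) <=
    e^-1 * Ioo_int a b (fun t => double_well (u t)) +
      e ^+ 3 * Ioo_int a b (fun t => W22_d2 u t ^+ 2) + C ->
  e^-1 * Ioo_int a b (fun t => double_well (u t)) <= C2 /\
  e * Ioo_int a b (fun t => W22_d1 u t ^+ 2) <= C2.
Proof.
move=> k0 kk' C0; have k'0 : 0 < k' by rewrite (lt_trans k0).
have dk : 0 < k' - k by rewrite subr_gt0.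
pose D := (M + C) / (k' - k).
exists (Num.max D (M + k * D)) => a b e u e0; rewrite energyE//.
have : 0 <= e^-1 * Ioo_int a b (fun t => double_well (u t)).
  by rewrite mulr_ge0 ?invr_ge0 ?(ltW e0)//; apply: Ioo_int_ge0 => t _; exact: double_well_ge0.
have : 0 <= e ^+ 3 * Ioo_int a b (fun t => W22_d2 u t ^+ 2).
  by rewrite mulr_ge0 ?exprn_ge0 ?(ltW e0)//; apply: Ioo_int_ge0 => t _; exact: sqr_ge0.
move: (e^-1 * _) (e ^+ 3 * _) (e * _) => W B A B0 W0 FM HK.
have AD : A <= D by rewrite /D ler_pdivlMr//; lra.
have kA : k * A <= k * D by rewrite ler_pM2l.
by rewrite !le_max AD; split => //; apply/orP; right; lra.
Qed.

(** * Subsequences and conclusion *)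

Section Final.
Context {R : realType}.

Lemma limn_einf_lt_frequently (f : nat -> R) : (limn_einf (fun n => (f n)%:E) < +oo)%E ->
  exists M : R, forall N : nat, exists2 n, (N <= n)%N & f n <= M.
Proof.
move=> h; have [M hM] : exists M : R, (limn_einf (fun n => (f n)%:E) < M%:E)%E.
  move: h; case: (limn_einf _) => [r _|//|_]; last by exists 0; rewrite ltNyr.
  by exists (r + 1); rewrite lte_fin ltrDl.
exists M => N; apply: contrapT => /forall2NP H.
move: hM; rewrite ltNge => /negP; apply.
rewrite limn_einf_lim; apply: lime_ge; first exact: is_cvg_einfs.
near=> n; apply: le_ereal_inf_tmp => _ [m /= nm <-]; rewrite lee_fin.
have [Nm|/negP] := H m; last by rewrite -ltNge => /ltW.
exfalso; apply: Nm; apply: leq_trans nm.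
by near: n; exact: nbhs_infty_ge.
Unshelve. all: by end_near. Qed.

Lemma ultra_refine (S : set nat) : (forall N : nat, exists2 n, (N <= n)%N & S n) ->
  exists U : set_system nat, [/\ UltraFilter U, U S & U `=>` \oo].
Proof.
move=> H; have PF : ProperFilter (within S \oo).
  constructor; last exact: within_filter.
  rewrite /within /= => -[N _ HN].
  by have [n Nn Sn] := H N; exact: (HN n Nn Sn).
have [U [FU sU]] := ultraFilterLemma PF.
exists U; split => //.
  by apply: sU; rewrite /within /=; apply: nearW.
by move=> A [N _ HN]; apply: sU; exists N => // n Nn _; exact: HN.
Qed.

Lemma extract_subsequence (Q : nat -> set nat) :
  (forall k m : nat, exists2 n, (m < n)%N & Q k n) ->
  exists2 phi : nat -> nat, {homo phi : m n / (m < n)%N >-> (m < n)%N} & forall k, Q k (phi k).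
Proof.
move=> H.
have /choice[g Hg] : forall km : nat * nat, exists n, (km.2 < n)%N /\ Q km.1 n.
  by move=> [k m]; have [n mn Qn] := H k m; exists n.
pose phi := fix F k := if k is j.+1 then g (j.+1, F j) else g (0%N, 0%N).
exists phi.
  apply: homo_ltn => [y x z|i]; first exact: ltn_trans.
  by have [] := Hg (i.+1, phi i).
by case=> [|k]; [have [] := Hg (0%N, 0%N)|have [] := Hg (k.+1, phi k)].
Qed.

End Final.

Section Main.
Context {R : realType}.
Notation mu := (@lebesgue_measure R).

Lemma ae_of_Ioo_int_eq0 (a b : R) (f : R -> R) (P : R -> Prop) : measurable_fun `]a, b[ f ->
  Ioo_int a b (fun x => `|f x|) = 0 -> Ioo_integrable a b (fun x => `|f x|) ->
    (forall x, f x = 0 -> P x) ->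
  {ae lebesgue_measure, forall x, x \in `]a, b[ -> P x}.
Proof.
move=> mf f0 iF fP.
have : ae_eq mu `]a, b[%classic (EFin \o f) (cst 0%E).
  apply/ae_eq_integral_abs => //; first exact/measurable_EFinP.
  move: f0; rewrite /Rintegral => f0.
  have fin : (\int[mu]_(x in `]a, b[) (`|f x|)%:E)%E \is a fin_num by exact: integrable_fin_num.
  by rewrite -[LHS](fineK fin) f0.
by apply: filterS => x /= h xI; apply: fP; have [] := h xI.
Qed.

End Main.

Theorem proposition5p1 (R : realType) (a b k : R) (hab : a < b)
  (hk0 : 0 < k) (hk : (k%:E < mine k1_const (2^-1)%:E)%E)
  (eps : nat -> R) (heps0 : forall n, 0 < eps n)
  (heps : eps n @[n --> \oo] --> 0)
  (u : nat -> W22 a b)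
  (hu : forall n, exists2 x, x \in `]a, b[ & W22_d1 (u n) x = 0)
  (hF : (limn_einf (fun n => (energy k (eps n) (u n))%:E) < +oo)%E) :
  exists (phi : nat -> nat) (v : R -> R),
    [/\ {homo phi : m n / (m < n)%N >-> (m < n)%N},
        BV_pm1 a b v
      & (\int[lebesgue_measure]_(x in `]a, b[) `|u (phi n) x - v x|%:E)%E
          @[n --> \oo] --> 0%E].
Proof.
have [k' kk' k'1] : exists2 k' : R, k < k' & (k'%:E <= k1_const)%E.
  move: hk; rewrite lt_min => /andP[+ _]; case: k1_const => [r|_|//].
    by rewrite lte_fin => kr; exists r.
  by exists (k + 1); rewrite ?leey// ltrDl.
have k'0 : 0 < k' by exact: lt_trans kk'.
have [C C0 HC] := interpolation_bound k'0 k'1.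
have [M freq] := limn_einf_lt_frequently hF.
have [C2 HC2] := energy_coercive M hk0 kk' C0.
have [U [FU US Uoo]] := @ultra_refine [set n | energy k (eps n) (u n) <= M] freq.
have PU : ProperFilter U by exact: ultra_proper.
have epsU d : 0 < d -> \forall n \near U, eps n <= d.
  move=> d0; apply: Uoo; have /cvgrPdist_le/(_ _ d0) := heps.
  by apply: filterS => n; rewrite sub0r normrN ger0_norm// ltW.
have good : \forall n \near U,
    [/\ (eps n)^-1 * Ioo_int a b (fun t => double_well (u n t)) <= C2,
        eps n * Ioo_int a b (fun t => W22_d1 (u n) t ^+ 2) <= C2 & eps n <= 1].
  have := epsU _ ltr01; apply: filterS2 US => n En e1.
  have [x xI ux] := hu n.
  by have [h1 h2] := HC2 _ _ _ (u n) (heps0 n) En (HC _ _ _ _ (u n) hab (heps0 n) xI ux).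
pose B := (1 + ((C2 + 1) / (b - a) + 2)) * (3 + ((C2 + 1) / (b - a) + 2)) + 3 * C2.
pose zs n x := mm_profile (u n x).
have cz n : {within `[a, b], continuous (zs n)}
  by apply: W22_continuous_comp; exact: continuous_mm_profile.
have zB : \forall n \near U, forall x, x \in `[a, b] -> `|zs n x| <= B.
  by apply: filterS good => n [h1 h2 h3] x xI;
    exact: (mm_profile_bounded hab (heps0 n) h1 h2 h3 xI).
have [z [mz zzB zlim]] : exists z : R -> R,
   [/\ measurable_fun `]a, b[ z, forall x, x \in `[a, b] -> `|z x| <= B &
      Ioo_int a b (fun x => `|zs n x - z x|) @[n --> U] --> (0 : R)].
  apply: (@bv_ultra_limit R a b B (3 * C2) hab U zs (fun n => mm_measure (u n) (eps n))) => //.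
  - by apply: filterS good => n [h1 h2 _] x xI; exact: (mm_measure_bound (heps0 n) h1 h2 xI).
  - by apply: filterS good => n [h1 h2 _] x y xI yI xy;
    exact: (mm_profile_variation (u n) (heps0 n) xI yI xy).
  - by move=> n; apply: Ioo_integrable_measurable; exact: Ioo_integrable_continuous.
have iz : Ioo_integrable a b z.
  apply: (Ioo_integrable_dominated (g := fun=> B)) => //; first exact: Ioo_integrable_cst.
  by move=> t tI; apply: zzB; exact: subset_itv_oo_cc.
have izs n : Ioo_integrable a b (zs n) by exact: Ioo_integrable_continuous.
have B0 : 0 <= B by apply: le_trans (zzB a _); rewrite // in_itv/= lexx ltW.
have WU d : 0 < d -> \forall n \near U, Ioo_int a b (fun t => double_well (u n t)) <= d.
  move=> d0.
  have C2p : 0 < `|C2| + 1 by rewrite ltr_wpDl.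
  have := epsU (d / (`|C2| + 1)) (divr_gt0 d0 C2p).
  apply: filterS2 good => n [h1 _ _] he.
  have : Ioo_int a b (fun t => double_well (u n t)) <= eps n * C2 by rewrite -ler_pdivrMl.
  move/le_trans; apply.
  apply: (@le_trans _ _ (eps n * (`|C2| + 1))).
    by rewrite ler_pM2l//; have := ler_norm C2; lra.
  by rewrite -ler_pdivlMr.
have uB : \forall n \near U, forall x, x \in `[a, b] -> u n x ^+ 2 <= B ^+ 2 + 5.
  apply: filterS zB => n h x xI; rewrite (le_trans (mm_profile_coercive _))// lerD2r.
  by rewrite -(real_normK (num_real (mm_profile _))) ler_sqr ?nnegrE// h.
pose Q := B ^+ 2 + 5.
have Q0 : 0 < Q by rewrite ltr_wpDl ?sqr_ge0.
have zd d : 0 < d -> \forall n \near U, Ioo_int a b (fun x => `|zs n x - z x|) <= d.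
  move=> d0; have /cvgrPdist_le/(_ _ d0) := zlim.
  by apply: filterS => n; rewrite sub0r normrN ger0_norm// Ioo_int_ge0.
have inoc t : t \in `]a, b[ -> t \in `[a, b] by exact: subset_itv_oo_cc.
have izz n : Ioo_integrable a b (fun x => `|zs n x - z x|)
  by apply: Ioo_integrable_norm; exact: Ioo_integrableB.
(* z_n^2 - 1 = W(u_n) (u_n^2 - 4) tends to 0 in L^1 *)
have mz2 : measurable_fun `]a, b[ (fun x => z x ^+ 2 - 1).
  by apply: measurable_funB => //; exact: measurable_funX.
have iz2 : Ioo_integrable a b (fun x => `|z x ^+ 2 - 1|).
  apply: Ioo_integrable_norm; apply: (Ioo_integrable_dominated (g := fun=> B ^+ 2 + 1)) => //;
    first exact: Ioo_integrable_cst.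
  move=> t tI; rewrite (le_trans (ler_normB _ _))// normr1 lerD2r normrX.
  by rewrite ler_sqr ?nnegrE// zzB// inoc.
have z2 : Ioo_int a b (fun x => `|z x ^+ 2 - 1|) = 0.
  apply/eqP; rewrite eq_le; apply/andP; split; last by apply: Ioo_int_ge0 => t _.
  apply/ler_addgt0Pr => d d0; rewrite add0r.
  have d1 : 0 < d / (2 * (Q + 4)) by rewrite divr_gt0// mulr_gt0// ltr_wpDl// ltW.
  have d2 : 0 < d / (2 * (2 * B + 1)).
    by rewrite divr_gt0// mulr_gt0// ltr_wpDl// mulr_ge0.
  have [n [[[hW hz] hB] hQ]] := filter_ex (filterI (filterI (filterI (WU _ d1) (zd _ d2)) zB) uB).
  have iW := W22_double_well_integrable (u n).
  have : Ioo_int a b (fun x => `|z x ^+ 2 - 1|) <=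
    Ioo_int a b (fun x => (Q + 4) * double_well (u n x) + (2 * B) * `|zs n x - z x|).
    apply: Ioo_int_le => //; first by apply: Ioo_integrableD; exact: Ioo_integrableZ.
    move=> t tI.
    have e1 : z t ^+ 2 - 1 = (zs n t ^+ 2 - 1) - (zs n t - z t) * (zs n t + z t) by ring.
    rewrite e1 (le_trans (ler_normB _ _))// lerD//.
      rewrite mm_profile_sqr normrM ger0_norm ?double_well_ge0// mulrC ler_wpM2r
        ?double_well_ge0//.
      have := hQ t (inoc _ tI); have := sqr_ge0 (u n t); rewrite -/Q => q0 q1.
      by rewrite ler_norml; apply/andP; split; lra.
    rewrite normrM mulrC ler_wpM2r// (le_trans (ler_normD _ _))//.
    have := hB t (inoc _ tI); have := zzB t (inoc _ tI); lra.
  rewrite Ioo_intD; [|exact: Ioo_integrableZ|exact: Ioo_integrableZ].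
  rewrite !Ioo_intZ// => H; apply: (le_trans H).
  rewrite (splitr d); apply: lerD.
    rewrite mulrC -ler_pdivlMr; last by rewrite ltr_wpDl// ltW.
    by rewrite (le_trans hW)// -mulrA -invfM.
  apply: (@le_trans _ _ ((2 * B + 1) * Ioo_int a b (fun x => `|zs n x - z x|))).
    by rewrite ler_wpM2r ?lerDl// Ioo_int_ge0.
  rewrite mulrC -ler_pdivlMr; last by rewrite ltr_wpDl// mulr_ge0.
  by rewrite (le_trans hz)// -mulrA -invfM.
have zpm : {ae lebesgue_measure, forall x, x \in `]a, b[ -> z x = -1 \/ z x = 1}.
  apply: (ae_of_Ioo_int_eq0 mz2 z2 iz2) => x /eqP.
  by rewrite subr_eq0 sqrf_eq1 => /orP[/eqP ->|/eqP ->]; [right|left].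
(* u_n - z_n is bounded by a multiple of t + W(u_n) / t: t is chosen first, then n *)
have iuz n : Ioo_integrable a b (fun x => `|u n x - z x|).
  by apply: Ioo_integrable_norm; apply: Ioo_integrableB => //;
    exact: Ioo_integrable_continuous (@W22_continuous _ _ _ (u n)).
have ulim d : 0 < d -> \forall n \near U, Ioo_int a b (fun x => `|u n x - z x|) <= d.
  move=> d0.
  have d2 : 0 < d / 2 by rewrite divr_gt0.
  have Q1 : 0 < 1 + Q by rewrite addr_gt0.
  have ba : 0 < b - a by rewrite subr_gt0.
  have [t t0 tE] : exists2 t : R, 0 < t & (1 + Q) / 2 * (t * (b - a)) = d / 4.
    exists (d / (2 * (1 + Q) * (b - a))); first by rewrite divr_gt0// !mulr_gt0.
    by field; rewrite !lt0r_neq0.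
  have [s s0 sE] : exists2 s : R, 0 < s & (1 + Q) / 2 * (4 / t * s) = d / 4.
    exists (d * t / (8 * (1 + Q))); first by rewrite divr_gt0// ?mulr_gt0.
    by field; rewrite !lt0r_neq0.
  apply: filterS (filterI (filterI (WU _ s0) (zd _ d2)) uB) => n [[hW hz] hQ].
  have iW := W22_double_well_integrable (u n).
  have i1 : Ioo_integrable a b (fun x => (1 + Q) / 2 * (t + 4 / t * double_well (u n x))).
    by apply: Ioo_integrableZ; apply: Ioo_integrableD;
      [exact: Ioo_integrable_cst|exact: Ioo_integrableZ].
  have : Ioo_int a b (fun x => `|u n x - z x|) <=
     Ioo_int a b (fun x => (1 + Q) / 2 * (t + 4 / t * double_well (u n x)) + `|zs n x - z x|).
    apply: Ioo_int_le => //; first exact: Ioo_integrableD.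
    move=> x xI; have -> : u n x - z x = (u n x - zs n x) + (zs n x - z x) by ring.
    rewrite (le_trans (ler_normD _ _))// lerD2r; apply: sub_mm_profile_le => //.
    have := hQ x (inoc _ xI); rewrite -/Q -(real_normK (num_real (u n x))).
    have := normr_ge0 (u n x); nra.
  rewrite Ioo_intD// Ioo_intZ; last
    by apply: Ioo_integrableD; [exact: Ioo_integrable_cst|exact: Ioo_integrableZ].
  rewrite Ioo_intD; [|exact: Ioo_integrable_cst|exact: Ioo_integrableZ].
  rewrite (Ioo_int_cst _ (ltW hab)) Ioo_intZ// mulrDr tE => H.
  have : (1 + Q) / 2 * (4 / t * Ioo_int a b (fun x => double_well (u n x))) <= d / 4.
    by rewrite -sE ler_pM2l ?divr_gt0// ler_pM2l// divr_gt0.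
  move: H hz; lra.
have [phi phi_mono phiQ] : exists2 phi : nat -> nat, {homo phi : m n / (m < n)%N >-> (m < n)%N} &
    forall j, Ioo_int a b (fun x => `|u (phi j) x - z x|) <= j.+1%:R^-1.
  apply: (@extract_subsequence (fun j => [set n | Ioo_int a b (fun x => `|u n x - z x|) <=
    j.+1%:R^-1])) => j m.
  have j0 : 0 < j.+1%:R^-1 :> R by rewrite invr_gt0.
  have mU : \forall n \near U, (m < n)%N by apply: Uoo; exists m.+1.
  by have [n [h1 h2]] := filter_ex (filterI mU (ulim _ j0)); exists n.
exists phi, z; split => //.
- split => //; split => //.
  apply: (@le_lt_trans _ _ (3 * C2)%:E); last by rewrite ltry.
  apply: ge_ereal_sup => _ [psi [cpsi psi1] <-]; rewrite lee_fin.
  have [p1 p2] := C1c_within cpsi.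
  have [P HP] := within_bounded p2.
  have P0 : 0 <= P by apply: le_trans (HP a _); rewrite // in_itv/= lexx ltW.
  have i1 : Ioo_integrable a b (fun x => z x * derive1 psi x)
    by exact: Ioo_integrableM_continuous.
  have i2 n : Ioo_integrable a b (fun x => zs n x * derive1 psi x)
    by exact: Ioo_integrableM_continuous.
  apply/ler_addgt0Pr => d d0.
  have P1 : 0 < P + 1 by rewrite ltr_wpDl.
  have [n [hz [h1 h2 _]]] := filter_ex (filterI (zd _ (divr_gt0 d0 P1)) good).
  have hw := mm_profile_weak_le hab (heps0 n) h1 h2 cpsi psi1.
  have : Ioo_int a b (fun x => z x * derive1 psi x) <=
      Ioo_int a b (fun x => zs n x * derive1 psi x + P * `|zs n x - z x|).
    apply: Ioo_int_le => //; first by apply: Ioo_integrableD => //; exact: Ioo_integrableZ.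
    move=> x xI; rewrite -lerBlDl -mulrBl (le_trans (ler_norm _))// normrM distrC mulrC.
    by rewrite ler_wpM2r// HP// inoc.
  rewrite Ioo_intD//; last exact: Ioo_integrableZ.
  rewrite Ioo_intZ// => H; apply: (le_trans H); apply: lerD; first exact: hw.
  apply: (@le_trans _ _ ((P + 1) * Ioo_int a b (fun x => `|zs n x - z x|))).
    by rewrite ler_wpM2r ?lerDl// Ioo_int_ge0.
  by rewrite mulrC -ler_pdivlMr.
- have E n : (\int[lebesgue_measure]_(x in `]a, b[) `|u (phi n) x - z x|%:E)%E =
  (Ioo_int a b (fun x => `|u (phi n) x - z x|))%:E.
    have fin : (\int[lebesgue_measure]_(x in `]a, b[) `|u (phi n) x - z x|%:E)%E \is a fin_num.
      by apply: integrable_fin_num => //; exact: iuz.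
    by rewrite -[LHS](fineK fin).
  have -> : (fun n => (\int[lebesgue_measure]_(x in `]a, b[) `|u (phi n) x - z x|%:E)%E) =
      (fun n => (Ioo_int a b (fun x => `|u (phi n) x - z x|))%:E) by apply/funext.
  apply: cvg_EFin; first exact: nearW.
  apply/cvgrPdist_le => d d0; near=> n.
  rewrite sub0r normrN ger0_norm; last by apply: Ioo_int_ge0.
  apply: (le_trans (phiQ n)); apply: ltW.
  by near: n; exact: near_infty_natSinv_lt (PosNum d0).
Unshelve. all: by end_near. Qed.
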